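(* Under the identification of the tree $X^{k}\prod_iI_{a_i}(\sigma_i)$ with the ordered monomial $X_0^{k_0}\cdots X_d^{k_d}\prod_iI_{a_i}(\sigma_i)\in U(\mathcal V_0)$, the product $\star_2$ coincides with the product $*$ obtained by extending the post-Lie product $\widehat{\triangleright}$ to the universal envelope $U(\mathcal V_0)$. One has, for every $\sigma=X^{k}\prod_iI_{a_i}(\sigma_i)$, every decorated tree $\tau$ and every $b\in\mathbb{N}^{d+1}$, $$I_b(\sigma\star_2\tau)=\sigma\,\widehat{\triangleright}\,I_b(\tau).$$
   Context: Here $\mathbb{N}=\{0,1,2,\dots\}$, $d\ge 0$ is fixed, and $e_0,\dots,e_d$ is the canonical basis of $\mathbb{N}^{d+1}$. For $k,\ell\in\mathbb{N}^{d+1}$, $\binom{k}{\ell}=\prod_i\binom{k_i}{\ell_i}$. Decorated trees. A decorated tree is a finite non-planar rooted tree (up to isomorphism) with a node decoration $\mathfrak{n}_v\in\mathbb{N}^{d+1}$ at each node $v$ and an edge decoration on each edge, which is either $(I,a)$ with $a\in\mathbb{N}^{d+1}$, or $(\Xi,0)$ (a noise edge). Noise edges are terminal, and their leaf has node decoration $0$; nothing may be grafted onto, and no decoration inserted at, the leaf of a noise edge. Accordingly $N_\tau$ denotes the set of nodes of $\tau$ other than leaves of noise edges. $\mathfrak{T}$ is the set of decorated trees. All operations are extended (bi)linearly. $I_a(\tau)$ is the planted tree obtained by joining the root of $\tau$ to a new root of decoration $0$ by an edge decorated $(I,a)$; $I_a(\tau)=0$ if $a\notin\mathbb{N}^{d+1}$.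 The tree $X^k\prod_iI_{a_i}(\sigma_i)$ (finite product) is obtained by identifying the roots of the planted trees $I_{a_i}(\sigma_i)$ and giving the root decoration $k\in\mathbb{N}^{d+1}$. Operations. For $v\in N_\tau$, $k\in\mathbb{Z}^{d+1}$, $\uparrow_v^{k}\tau$ adds $k$ to the decoration of $v$ (and is $0$ if the result is not in $\mathbb{N}^{d+1}$). $\sigma\curvearrowright^{a}_v\tau$ joins the root of $\sigma$ to the node $v$ of $\tau$ by a new edge decorated $(I,a)$ (and is $0$ if $a\notin\mathbb{N}^{d+1}$). The deformed grafting is $\sigma\,\widehat{\curvearrowright}^{a}\,\tau=\sum_{v\in N_\tau}\sum_{\ell\in\mathbb{N}^{d+1}}\binom{\mathfrak{n}_v}{\ell}\,\sigma\curvearrowright_v^{a-\ell}(\uparrow_v^{-\ell}\tau)$, and on planted trees $I_a(\sigma)\,\widehat{\curvearrowright}\,I_b(\tau)=I_b(\sigma\,\widehat{\curvearrowright}^{a}\,\tau)$; this is a pre-Lie product on the span of planted trees. It is extended to commutative products $A$ of planted trees acting on a planted tree $w$ by the Guin–Oudom rule: $\mathbf 1\,\widehat{\curvearrowright}\,w=w$, $(xA)\,\widehat{\curvearrowright}\,w=x\,\widehat{\curvearrowright}\,(A\,\widehat{\curvearrowright}\,w)-(x\,\widehat{\curvearrowright}\,A)\,\widehat{\curvearrowright}\,w$, where $x$ is a planted tree and $x\,\widehat{\curvearrowright}\,\cdot$ acts on $A$ as a derivation. Also $\uparrow^i\tau=\sum_{v\in N_\tau}\uparrow_v^{e_i}\tau$,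 and on planted trees $\uparrow^i I_a(\tau)=I_a(\uparrow^i\tau)$ (the root of a planted tree keeps decoration $0$). The product $\star_2$. For $\sigma=X^k\prod_iI_{a_i}(\sigma_i)$ and $\tau\in\mathfrak T$, $\sigma\star_2\tau$ is characterised, for any $b\in\mathbb{N}^{d+1}$, by $$I_b(\sigma\star_2\tau)=\tilde{\uparrow}^{k}_{N_\tau}\Big(\prod_iI_{a_i}(\sigma_i)\,\widehat{\curvearrowright}\,I_b(\tau)\Big),\qquad \tilde{\uparrow}^{k}_{N_\tau}=\sum_{k=\sum_{v\in N_\tau}k_v}\ \prod_{v\in N_\tau}\uparrow^{k_v}_v,$$ where the sum is over families $(k_v)_{v\in N_\tau}$ in $\mathbb{N}^{d+1}$, and only nodes originating from $\tau$ are incremented. The post-Lie algebra. $\mathcal V$ is the real vector space with basis $\{I_a(\tau):a\in\mathbb{N}^{d+1},\tau\in\mathfrak T\}\cup\{X_0,\dots,X_d\}$, with the $X_i$ formal symbols, and $\tilde{\mathcal V}$ is the span of the $I_a(\tau)$. The bilinear product $\widehat{\triangleright}$ on $\mathcal V$ is given by $X_i\,\widehat{\triangleright}\,I_a(\tau)=\uparrow^iI_a(\tau)$, $I_a(\tau)\,\widehat{\triangleright}\,X_i=0$, $X_i\,\widehat{\triangleright}\,X_j=0$, $I_a(\sigma)\,\widehat{\triangleright}\,I_b(\tau)=I_a(\sigma)\,\widehat{\curvearrowright}\,I_b(\tau)$. The Lie bracket $[\cdot,\cdot]_0$ vanishes on $\tilde{\mathcal V}\times\tilde{\mathcal V}$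 and on pairs from the span of the $X_i$, and $[I_a(\tau),X_i]_0=I_{a-e_i}(\tau)$. Then $(\mathcal V,[\cdot,\cdot]_0,\widehat{\triangleright})$ is a post-Lie algebra, and $U(\mathcal V_0)$ denotes the universal enveloping algebra of $(\mathcal V,[\cdot,\cdot]_0)$; by Poincaré–Birkhoff–Witt the monomials $X_0^{k_0}\cdots X_d^{k_d}\,I_{a_1}(\sigma_1)\cdots I_{a_n}(\sigma_n)$ (the $I$ factors commute) form a basis of it. The product $*$. Let $\Delta$ be the coproduct of $U(\mathcal V_0)$ with $\Delta x=x\otimes\mathbf 1+\mathbf 1\otimes x$ for $x\in\mathcal V$, extended multiplicatively, with Sweedler notation $\Delta A=\sum_{(A)}A^{(1)}\otimes A^{(2)}$. Extend $\widehat{\triangleright}$ to $U(\mathcal V_0)\otimes U(\mathcal V_0)$ by: for $x,y,y_j\in\mathcal V$, $A,B,C\in U(\mathcal V_0)$, $x\,\widehat{\triangleright}\,\mathbf 1=0$, $x\,\widehat{\triangleright}\,y_1\cdots y_n=\sum_{j}y_1\cdots(x\,\widehat{\triangleright}\,y_j)\cdots y_n$, $\mathbf 1\,\widehat{\triangleright}\,A=A$, $xA\,\widehat{\triangleright}\,y=x\,\widehat{\triangleright}\,(A\,\widehat{\triangleright}\,y)-(x\,\widehat{\triangleright}\,A)\,\widehat{\triangleright}\,y$, $A\,\widehat{\triangleright}\,BC=\sum_{(A)}(A^{(1)}\,\widehat{\triangleright}\,B)(A^{(2)}\,\widehat{\triangleright}\,C)$. Then $A*B=\sum_{(A)}A^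{(1)}(A^{(2)}\,\widehat{\triangleright}\,B)$.
   Formalization: In the sum defining the operator ↑̃^k over N_τ, each family (k_v) is weighted by the multinomial coefficient k!/∏_v k_v!; with all coefficients 1 the identity fails, e.g. for σ = X_0^2 and a tree τ with two nodes. *)

(* Defs.v *)
From HB Require Import structures.
From mathcomp Require Import all_boot all_algebra.
From mathcomp Require Import finmap generic_quotient boolp reals.
From mathcomp.multinomials Require Import monalg.

Set Implicit Arguments.
Unset Strict Implicit.
Unset Printing Implicit Defensive.

Import GRing.Theory.
Local Open Scope ring_scope.
Local Open Scope quotient_scope.

(* ------------------------------------------------------------------------ *)
(* Universal enveloping algebra of the Lie algebra (V, br).                 *)
(* Its elements are the noncommutative polynomial expressions in elements   *)
(* of V, two expressions being identified when they take the same value     *)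
(* under every Lie map from V to a unital associative algebra: this is the  *)
(* initial object of the category of such maps.                             *)
(* ------------------------------------------------------------------------ *)

Section Envelope.
Variables (R : fieldType) (V : lmodType R) (br : V -> V -> V).

Definition lie_map (A : algType R) (f : V -> A) : Prop :=
  linear f /\ forall x y, f (br x y) = f x * f y - f y * f x.

Inductive uterm : Type :=
  | Uzero | Uone | Uvar of V
  | Uadd of uterm & uterm | Umul of uterm & uterm | Uscale of R & uterm.

HB.instance Definition _ := gen_eqMixin uterm.
HB.instance Definition _ := gen_choiceMixin uterm.

Fixpoint ueval (A : algType R) (f : V -> A) (t : uterm) : A :=
  match t with
  | Uzero => 0
  | Uone => 1
  | Uvar x => f x
  | Uadd s t => ueval f s + ueval f t
  | Umul s t => ueval f s * ueval f t
  | Uscale c t => c *: ueval f t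
  end.

Definition ueq (s t : uterm) : Prop :=
  forall (A : algType R) (f : V -> A), lie_map f -> ueval f s = ueval f t.

Definition ueqb (s t : uterm) : bool := `[< ueq s t >].

Lemma ueqb_refl : reflexive ueqb.
Proof. by move=> s; apply/asboolP. Qed.

Lemma ueqb_sym : symmetric ueqb.
Proof.
by move=> s t; apply/asboolP/asboolP => h A f lf; rewrite (h A f lf).
Qed.

Lemma ueqb_trans : transitive ueqb.
Proof.
move=> t s u /asboolP st /asboolP tu; apply/asboolP => A f lf.
by rewrite (st A f lf) (tu A f lf).
Qed.

Canonical ueqb_equiv := EquivRel ueqb ueqb_refl ueqb_sym ueqb_trans.

Definition uea : Type := {eq_quot ueqb}.
HB.instance Definition _ := Choice.on uea.
HB.instance Definition _ := EqQuotient.on uea.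

Definition ulift (A : algType R) (f : V -> A) (x : uea) : A := ueval f (repr x).

Lemma uea_pi_eq (s t : uterm) : ueq s t -> \pi_uea s = \pi_uea t.
Proof. by move=> st; apply/eqmodP/asboolP. Qed.

Lemma ulift_pi (A : algType R) (f : V -> A) (s : uterm) :
  lie_map f -> ulift f (\pi_uea s) = ueval f s.
Proof.
move=> lf; have : repr (\pi_uea s) = s %[mod uea] by rewrite reprK.
by move/eqmodP/asboolP; apply.
Qed.

Lemma ueaP (x y : uea) :
  (forall (A : algType R) (f : V -> A), lie_map f -> ulift f x = ulift f y) ->
  x = y.
Proof.
by move=> xy; rewrite -(reprK x) -(reprK y); apply: uea_pi_eq.
Qed.

Definition uzero : uea := \pi_uea Uzero.
Definition uone : uea := \pi_uea Uone.
Definition uinj (x : V) : uea := \pi_uea (Uvar x).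
Definition uadd (x y : uea) : uea := \pi_uea (Uadd (repr x) (repr y)).
Definition umul (x y : uea) : uea := \pi_uea (Umul (repr x) (repr y)).
Definition uscale (c : R) (x : uea) : uea := \pi_uea (Uscale c (repr x)).
Definition uopp (x : uea) : uea := uscale (-1) x.

Lemma uliftE (A : algType R) (f : V -> A) : lie_map f ->
  (((ulift f uzero = 0%R) * (ulift f uone = 1%R)) *
   ((forall x, ulift f (uinj x) = f x) *
    (forall x y, ulift f (uadd x y) = (ulift f x + ulift f y)%R)) *
   ((forall x y, ulift f (umul x y) = (ulift f x * ulift f y)%R) *
    (forall c x, ulift f (uscale c x) = (c *: ulift f x)%R)))%type.
Proof. by move=> lf; repeat split=> *; rewrite ulift_pi. Qed.

Fact uaddA : associative uadd.
Proof. by move=> *; apply: ueaP => A f lf; rewrite !(uliftE lf) addrA. Qed.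
Fact uaddC : commutative uadd.
Proof. by move=> *; apply: ueaP => A f lf; rewrite !(uliftE lf) addrC. Qed.
Fact uadd0 : left_id uzero uadd.
Proof. by move=> *; apply: ueaP => A f lf; rewrite !(uliftE lf) add0r. Qed.
Fact uaddN : left_inverse uzero uopp uadd.
Proof. by move=> *; apply: ueaP => A f lf; rewrite !(uliftE lf) scaleN1r addNr. Qed.

HB.instance Definition _ := GRing.isZmodule.Build uea uaddA uaddC uadd0 uaddN.

Fact umulA : associative umul.
Proof. by move=> *; apply: ueaP => A f lf; rewrite !(uliftE lf) mulrA. Qed.
Fact umul1l : left_id uone umul.
Proof. by move=> *; apply: ueaP => A f lf; rewrite !(uliftE lf) mul1r. Qed.
Fact umul1r : right_id uone umul.
Proof. by move=> *; apply: ueaP => A f lf; rewrite !(uliftE lf) mulr1. Qed.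
Fact umulDl : left_distributive umul uadd.
Proof. by move=> *; apply: ueaP => A f lf; rewrite !(uliftE lf) mulrDl. Qed.
Fact umulDr : right_distributive umul uadd.
Proof. by move=> *; apply: ueaP => A f lf; rewrite !(uliftE lf) mulrDr. Qed.
Fact uone_neq0 : uone != uzero.
Proof.
apply/eqP => /(congr1 (ulift (fun _ : V => 0 : R^o))).
have l0 : lie_map (fun _ : V => 0 : R^o).
  by split=> [c x y|x y]; rewrite ?scaler0 ?addr0 // mul0r subr0.
by rewrite !ulift_pi //=; apply/eqP/oner_neq0.
Qed.

HB.instance Definition _ := GRing.Zmodule_isNzRing.Build uea
  umulA umul1l umul1r umulDl umulDr uone_neq0.

Fact uscaleA c1 c2 x : uscale c1 (uscale c2 x) = uscale (c1 * c2) x.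
Proof. by move=> *; apply: ueaP => A f lf; rewrite !(uliftE lf) scalerA. Qed.
Fact uscale1 : left_id 1 uscale.
Proof. by move=> *; apply: ueaP => A f lf; rewrite !(uliftE lf) scale1r. Qed.
Fact uscaleDr : right_distributive uscale +%R.
Proof. by move=> *; apply: ueaP => A f lf; rewrite !(uliftE lf) scalerDr. Qed.
Fact uscaleDl x : {morph uscale^~ x : c1 c2 / c1 + c2}.
Proof. by move=> *; apply: ueaP => A f lf; rewrite !(uliftE lf) scalerDl. Qed.

HB.instance Definition _ := GRing.Zmodule_isLmodule.Build R uea
  uscaleA uscale1 uscaleDr uscaleDl.

Fact uscaleAl (c : R) (x y : uea) : c *: (x * y) = (c *: x) * y.
Proof. by move=> *; apply: ueaP => A f lf; rewrite !(uliftE lf) scalerAl. Qed.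
Fact uscaleAr (c : R) (x y : uea) : c *: (x * y) = x * (c *: y).
Proof. by move=> *; apply: ueaP => A f lf; rewrite !(uliftE lf) scalerAr. Qed.

HB.instance Definition _ := GRing.Lmodule_isLalgebra.Build R uea uscaleAl.
HB.instance Definition _ := GRing.Lalgebra_isAlgebra.Build R uea uscaleAr.

End Envelope.

(* ------------------------------------------------------------------------ *)
(* The algebra A (x) A: finite formal sums of pairs, two of them being      *)
(* identified when every bilinear map takes the same value on both.         *)
(* ------------------------------------------------------------------------ *)

Section Tensor.
Variables (R : fieldType) (A : algType R).

Definition bilinear_map (W : lmodType R) (f : A -> A -> W) : Prop :=
  (forall y, linear (f^~ y)) /\ (forall x, linear (f x)).

Definition tsum (W : lmodType R) (f : A -> A -> W) (s : seq (A * A)) : W :=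
  \sum_(p <- s) f p.1 p.2.

Definition teq (s t : seq (A * A)) : Prop :=
  forall (W : lmodType R) (f : A -> A -> W), bilinear_map f ->
    tsum f s = tsum f t.

Definition teqb (s t : seq (A * A)) : bool := `[< teq s t >].

Lemma teqb_refl : reflexive teqb.
Proof. by move=> s; apply/asboolP. Qed.

Lemma teqb_sym : symmetric teqb.
Proof.
by move=> s t; apply/asboolP/asboolP => h W f bf; rewrite (h W f bf).
Qed.

Lemma teqb_trans : transitive teqb.
Proof.
move=> t s u /asboolP st /asboolP tu; apply/asboolP => W f bf.
by rewrite (st W f bf) (tu W f bf).
Qed.

Canonical teqb_equiv := EquivRel teqb teqb_refl teqb_sym teqb_trans.

Definition tens : Type := {eq_quot teqb}.
HB.instance Definition _ := Choice.on tens.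
HB.instance Definition _ := EqQuotient.on tens.

(* For f bilinear and t = sum_i x_i (x) y_i, this is sum_i f x_i y_i. *)
Definition contract (W : lmodType R) (f : A -> A -> W) (t : tens) : W :=
  tsum f (repr t).

Lemma contract_pi (W : lmodType R) (f : A -> A -> W) (s : seq (A * A)) :
  bilinear_map f -> contract f (\pi_tens s) = tsum f s.
Proof.
move=> bf; have : repr (\pi_tens s) = s %[mod tens] by rewrite reprK.
by move/eqmodP/asboolP; apply.
Qed.

Lemma tensP (x y : tens) :
  (forall (W : lmodType R) (f : A -> A -> W), bilinear_map f ->
     contract f x = contract f y) -> x = y.
Proof.
by move=> xy; rewrite -(reprK x) -(reprK y); apply/eqmodP/asboolP.
Qed.

Definition tpure (x y : A) : tens := \pi_tens [:: (x, y)].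
Definition tzero : tens := \pi_tens [::].
Definition tone : tens := tpure 1 1.
Definition tadd (s t : tens) : tens := \pi_tens (repr s ++ repr t).
Definition tscale (c : R) (s : tens) : tens :=
  \pi_tens [seq (c *: p.1, p.2) | p <- repr s].
Definition topp (s : tens) : tens := tscale (-1) s.
Definition tmul (s t : tens) : tens :=
  \pi_tens [seq (p.1 * q.1, p.2 * q.2) | p <- repr s, q <- repr t].

Lemma bilinear_mul (W : lmodType R) (f : A -> A -> W) (a b : A) :
  bilinear_map f -> bilinear_map (fun c e => f (a * c) (b * e)).
Proof.
move=> [f1 f2]; split=> [y c x x'|x c y y'] /=.
  by rewrite mulrDr -scalerAr f1.
by rewrite mulrDr -scalerAr f2.
Qed.

Lemma bilinear_contract (W : lmodType R) (f : A -> A -> W) (t : tens) :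
  bilinear_map f ->
  bilinear_map (fun a b => contract (fun c e => f (a * c) (b * e)) t).
Proof.
move=> [f1 f2]; split=> [y c x x'|x c y y'] /=;
  rewrite /contract /tsum scaler_sumr -big_split /=; apply: eq_bigr => p _.
  by rewrite mulrDl -scalerAl f1.
by rewrite mulrDl -scalerAl f2.
Qed.

Lemma contractE (W : lmodType R) (f : A -> A -> W) : bilinear_map f ->
  (((contract f tzero = 0%R) * (forall x y, contract f (tpure x y) = f x y)) *
   ((forall s t, contract f (tadd s t) = (contract f s + contract f t)%R) *
    (forall c s, contract f (tscale c s) = (c *: contract f s)%R)) *
   (forall s t, contract f (tmul s t) =
      contract (fun a b => contract (fun c e => f (a * c)%R (b * e)%R) t) s))%type.
Proof.
move=> bf; have [f1 _] := bf.
have f0 y : f 0 y = 0.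
  by have := f1 y (-1) 0 0; rewrite /= !scaleN1r !addNr.
repeat split; [|move=> x y|move=> s t|move=> c s|move=> s t];
  rewrite contract_pi // /tsum.
- by rewrite big_nil.
- by rewrite big_seq1.
- by rewrite big_cat.
- rewrite big_map /contract /tsum scaler_sumr; apply: eq_bigr => p _ /=.
  by have := f1 p.2 c p.1 0; rewrite /= f0 !addr0.
by rewrite big_allpairs_dep.
Qed.

Fact taddA : associative tadd.
Proof. by move=> *; apply: tensP => W f bf; rewrite !(contractE bf) addrA. Qed.
Fact taddC : commutative tadd.
Proof. by move=> *; apply: tensP => W f bf; rewrite !(contractE bf) addrC. Qed.
Fact tadd0 : left_id tzero tadd.
Proof. by move=> *; apply: tensP => W f bf; rewrite !(contractE bf) add0r. Qed.
Fact taddN : left_inverse tzero topp tadd.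
Proof.
by move=> *; apply: tensP => W f bf; rewrite !(contractE bf) scaleN1r addNr.
Qed.

HB.instance Definition _ := GRing.isZmodule.Build tens taddA taddC tadd0 taddN.

Lemma eq_contract (W : lmodType R) (f g : A -> A -> W) (t : tens) :
  (forall x y, f x y = g x y) -> contract f t = contract g t.
Proof. by move=> fg; apply: eq_bigr => p _; rewrite fg. Qed.

Lemma contractD (W : lmodType R) (f g : A -> A -> W) (t : tens) :
  contract (fun x y => f x y + g x y) t = contract f t + contract g t.
Proof. exact: big_split. Qed.

Lemma contractZ (W : lmodType R) (c : R) (f : A -> A -> W) (t : tens) :
  contract (fun x y => c *: f x y) t = c *: contract f t.
Proof. by rewrite /contract /tsum scaler_sumr. Qed.

Fact tmulA : associative tmul.
Proof.
move=> s t u; apply: tensP => W f bf; rewrite !(contractE bf).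
rewrite (contractE (bilinear_contract u bf)).
apply: eq_contract => a b; rewrite (contractE (bilinear_mul a b bf)).
by apply: eq_contract => c e; apply: eq_contract => g h; rewrite !mulrA.
Qed.
Fact tmul1l : left_id tone tmul.
Proof.
move=> s; apply: tensP => W f bf; rewrite (contractE bf).
rewrite (contractE (bilinear_contract s bf)).
by apply: eq_contract => a b; rewrite !mul1r.
Qed.
Fact tmul1r : right_id tone tmul.
Proof.
move=> s; apply: tensP => W f bf; rewrite (contractE bf).
by apply: eq_contract => a b; rewrite (contractE (bilinear_mul a b bf)) !mulr1.
Qed.
Fact tmulDl : left_distributive tmul tadd.
Proof.
move=> s t u; apply: tensP => W f bf; rewrite !(contractE bf).
by rewrite (contractE (bilinear_contract u bf)).
Qed.
Fact tmulDr : right_distributive tmul tadd.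
Proof.
move=> s t u; apply: tensP => W f bf; rewrite !(contractE bf).
rewrite -contractD; apply: eq_contract => a b.
by rewrite (contractE (bilinear_mul a b bf)).
Qed.
Fact tone_neq0 : tone != tzero.
Proof.
apply/eqP => /(congr1 (contract (fun x y : A => x * y))).
have bm : bilinear_map (fun x y : A => x * y).
  split=> [y c x x'|x c y y'] /=; first by rewrite mulrDl -scalerAl.
  by rewrite mulrDr -scalerAr.
by rewrite !(contractE bm) mulr1; apply/eqP/oner_neq0.
Qed.

HB.instance Definition _ := GRing.Zmodule_isNzRing.Build tens
  tmulA tmul1l tmul1r tmulDl tmulDr tone_neq0.

Fact tscaleA c1 c2 s : tscale c1 (tscale c2 s) = tscale (c1 * c2) s.
Proof. by apply: tensP => W f bf; rewrite !(contractE bf) scalerA. Qed.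
Fact tscale1 : left_id 1 tscale.
Proof. by move=> *; apply: tensP => W f bf; rewrite !(contractE bf) scale1r. Qed.
Fact tscaleDr : right_distributive tscale +%R.
Proof. by move=> *; apply: tensP => W f bf; rewrite !(contractE bf) scalerDr. Qed.
Fact tscaleDl s : {morph tscale^~ s : c1 c2 / c1 + c2}.
Proof. by move=> *; apply: tensP => W f bf; rewrite !(contractE bf) scalerDl. Qed.

HB.instance Definition _ := GRing.Zmodule_isLmodule.Build R tens
  tscaleA tscale1 tscaleDr tscaleDl.

Fact tscaleAl (c : R) (s t : tens) : c *: (s * t) = (c *: s) * t.
Proof.
apply: tensP => W f bf; rewrite !(contractE bf).
by rewrite (contractE (bilinear_contract t bf)).
Qed.
Fact tscaleAr (c : R) (s t : tens) : c *: (s * t) = s * (c *: t).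
Proof.
apply: tensP => W f bf; rewrite !(contractE bf).
rewrite -contractZ; apply: eq_contract => a b.
by rewrite (contractE (bilinear_mul a b bf)).
Qed.

HB.instance Definition _ := GRing.Lmodule_isLalgebra.Build R tens tscaleAl.
HB.instance Definition _ := GRing.Lalgebra_isAlgebra.Build R tens tscaleAr.

Lemma tpure_bilinear : bilinear_map tpure.
Proof.
split=> [y c x x'|x c y y'] /=; apply: tensP => W f bf;
  by rewrite !(contractE bf); case: bf => [f1 f2]; rewrite ?f1 ?f2.
Qed.

Lemma tpureM (a b c e : A) : tpure a b * tpure c e = tpure (a * c) (b * e).
Proof.
apply: tensP => W f bf; rewrite !(contractE bf).
rewrite (contractE (bilinear_contract _ bf)).
by rewrite (contractE (bilinear_mul _ _ bf)).
Qed.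

End Tensor.

(* ------------------------------------------------------------------------ *)
(* Coproduct of the enveloping algebra, extension of a product on V to the  *)
(* enveloping algebra, and the associated product.                          *)
(* ------------------------------------------------------------------------ *)

Section PostLieEnvelope.
Variables (R : fieldType) (V : lmodType R) (br : V -> V -> V).
Local Notation U := (uea br).
Local Notation uinj := (uinj br).

Definition primitive (x : V) : tens U := tpure (uinj x) 1 + tpure 1 (uinj x).

Definition coproduct (A : U) : tens U := ulift primitive A.

Lemma uinj_lie_map : lie_map br uinj.
Proof.
split=> [c x y|x y]; apply: ueaP => A f lf; have [lin comm] := lf.
  by rewrite !(uliftE lf) lin.
by rewrite !(uliftE lf) comm scaleN1r.
Qed.

Lemma primitive_lie_map : lie_map br primitive.
Proof.
have [lin comm] := uinj_lie_map; have [pl pr] := tpure_bilinear U.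
have plB (u v w : U) : tpure (u - v) w = tpure u w - tpure v w.
  by rewrite addrC -scaleN1r pl scaleN1r addrC.
have prB (u v w : U) : tpure w (u - v) = tpure w u - tpure w v.
  by rewrite addrC -scaleN1r pr scaleN1r addrC.
rewrite /primitive; split=> [c x y|x y].
  by rewrite lin pl pr scalerDr addrACA.
rewrite comm plB prB !mulrDl !mulrDr !tpureM !mulr1 !mul1r.
set a := tpure (_ * _) 1; set b := tpure (_ * _) 1.
set c := tpure 1 _; set e := tpure 1 _.
set g := tpure (uinj x) _; set h := tpure (uinj y) _.
have -> : a + g + (h + c) = a + c + (g + h) by rewrite [h + c]addrC addrACA.
have -> : b + h + (g + e) = b + e + (g + h).
  by rewrite [g + e]addrC addrACA [h + g]addrC.
by rewrite [- (_ + (g + h))]opprD [RHS]addrACA subrr addr0 opprD [RHS]addrACA.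
Qed.

Lemma coproduct_uinj (x : V) : coproduct (uinj x) = primitive x.
Proof. by rewrite /coproduct !(uliftE primitive_lie_map). Qed.

Lemma coproduct1 : coproduct 1 = 1.
Proof. by rewrite /coproduct !(uliftE primitive_lie_map). Qed.

Lemma coproductM (A B : U) : coproduct (A * B) = coproduct A * coproduct B.
Proof. by rewrite /coproduct !(uliftE primitive_lie_map). Qed.

Lemma coproductP (c : R) (A B : U) :
  coproduct (c *: A + B) = c *: coproduct A + coproduct B.
Proof. by rewrite /coproduct !(uliftE primitive_lie_map). Qed.

(* T is the extension to U of the product tri on V *)
Record extends_product (tri : V -> V -> V) (T : U -> U -> U) : Prop :=
  ExtendsProduct {
    ext_bilinear : (forall B, linear (T^~ B)) /\ (forall A, linear (T A));
    ext_V : forall x y : V, T (uinj x) (uinj y) = uinj (tri x y);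
    ext_V1 : forall x : V, T (uinj x) 1 = 0;
    ext_V_prod : forall (x : V) (n : nat) (y : 'I_n -> V),
      T (uinj x) (\prod_(i < n) uinj (y i)) =
      \sum_(j < n) \prod_(i < n)
         (if i == j then uinj (tri x (y i)) else uinj (y i));
    ext_1 : forall A : U, T 1 A = A;
    ext_mulV : forall (x : V) (A : U) (y : V),
      T (uinj x * A) (uinj y) =
      T (uinj x) (T A (uinj y)) - T (T (uinj x) A) (uinj y);
    ext_mul : forall A B C : U,
      T A (B * C) = contract (fun A1 A2 => T A1 B * T A2 C) (coproduct A)
  }.

Definition star (T : U -> U -> U) (A B : U) : U :=
  contract (fun A1 A2 => A1 * T A2 B) (coproduct A).

End PostLieEnvelope.

Definition lext (R : fieldType) (X : choiceType) (W : lmodType R)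
    (f : X -> W) (u : {malg R[X]}) : W :=
  \sum_(x <- msupp u) u@_x *: f x.

Section LinearExtension.
Variables (R : fieldType) (X : choiceType) (W : lmodType R).
Implicit Types (f g : X -> W) (u v : {malg R[X]}).

Lemma lextEw f u (D : {fset X}) :
  (msupp u `<=` D)%fset -> lext f u = \sum_(x <- D) u@_x *: f x.
Proof.
move=> uD; apply: (big_fset_incl _ uD) => x _ xu.
by rewrite (mcoeff_outdom xu) scale0r.
Qed.

Lemma lext_linear f : linear (lext f).
Proof.
move=> c u v; pose D := (msupp (c *: u + v)%R `|` (msupp u `|` msupp v))%fset.
rewrite !(@lextEw f _ D) ?fsubsetUl //; last 2 first.
- by rewrite /D fsetUA (fsetUC _ (msupp v)) fsubsetUl.
- by rewrite /D fsetUCA fsubsetUl.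
rewrite scaler_sumr -big_split /=; apply: eq_bigr => x _.
by rewrite mcoeffD mcoeffZ scalerDl scalerA.
Qed.

HB.instance Definition _ f :=
  GRing.isLinear.Build R {malg R[X]} W _ (lext f) (lext_linear f).

Lemma lextB f u v : lext f (u - v) = lext f u - lext f v.
Proof. exact: raddfB. Qed.

Lemma lext_sum f (I : Type) (r : seq I) (F : I -> {malg R[X]}) :
  lext f (\sum_(i <- r) F i) = \sum_(i <- r) lext f (F i).
Proof. exact: raddf_sum. Qed.

Lemma lextU f x : lext f << x >> = f x.
Proof.
rewrite (@lextEw f _ [fset x]%fset) ?msuppU_le //.
by rewrite big_seq_fset1 mcoeffUU scale1r.
Qed.

Lemma eq_lext f g u : f =1 g -> lext f u = lext g u.
Proof. by move=> fg; apply: eq_bigr => x _; rewrite fg. Qed.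

End LinearExtension.

Lemma lext_comp (R : fieldType) (X Y : choiceType) (W : lmodType R)
    (g : Y -> W) (f : X -> {malg R[Y]}) u :
  lext g (lext f u) = lext (fun x => lext g (f x)) u.
Proof. by rewrite {2 3}/lext linear_sum; apply: eq_bigr => x _; rewrite linearZ. Qed.

(* ------------------------------------------------------------------------ *)
(* Decorated trees.                                                         *)
(* ------------------------------------------------------------------------ *)

Definition mi (d : nat) : Type := {ffun 'I_d.+1 -> nat}.
HB.instance Definition _ d := Choice.on (mi d).
HB.instance Definition _ d := GRing.Nmodule.on (mi d).

Section MultiIndices.
Variable d : nat.
Implicit Types k l a : mi d.

Definition mile l k : bool := [forall i, l i <= k i]%N.
Definition misub k l : mi d := [ffun i => (k i - l i)%N].
Definition mie (i : 'I_d.+1) : mi d := [ffun j => (j == i : nat)].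
Definition mibin k l : nat := (\prod_i 'C(k i, l i))%N.
Definition mifact k : nat := (\prod_i (k i)`!)%N.

(* a finite type of multi-indices containing every l <= k *)
Definition box k : finType := {ffun 'I_d.+1 -> 'I_(\max_i k i).+1}.
Definition unbox k (l : box k) : mi d := [ffun i => l i : nat].

End MultiIndices.

(* PNode n x m [:: (a_1, t_1); ...; (a_p, t_p)] is the planar tree whose    *)
(* root has decoration n, mark x, m noise edges, and edges (I, a_j) leading *)
(* to the t_j. Leaves of noise edges carry no data, so a noise edge is      *)
(* determined by the node it is attached to, and all the nodes of the       *)
(* inductive type belong to N_tau. Marks only serve to remember the origin  *)
(* of nodes: decorated trees are the case M = unit.                         *)
Inductive ptree (d : nat) (M : Type) : Type :=
  PNode of mi d & M & nat & seq (mi d * ptree d M).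

HB.instance Definition _ d M := gen_eqMixin (ptree d M).
HB.instance Definition _ d M := gen_choiceMixin (ptree d M).

(* isomorphism of non-planar trees, and of forests attached to a node *)
Inductive tiso (d : nat) (M : Type) : ptree d M -> ptree d M -> Prop :=
  | TIso n x m cs ds : fiso cs ds -> tiso (PNode n x m cs) (PNode n x m ds)
with fiso (d : nat) (M : Type) :
    seq (mi d * ptree d M) -> seq (mi d * ptree d M) -> Prop :=
  | FIso_nil : fiso [::] [::]
  | FIso_cons a s t cs ds :
      tiso s t -> fiso cs ds -> fiso ((a, s) :: cs) ((a, t) :: ds)
  | FIso_swap c1 c2 cs : fiso [:: c1, c2 & cs] [:: c2, c1 & cs]
  | FIso_trans cs ds es : fiso cs ds -> fiso ds es -> fiso cs es.

Scheme tiso_fiso_ind := Minimality for tiso Sort Prop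
  with fiso_tiso_ind := Minimality for fiso Sort Prop.

Section Trees.
Variables (d : nat) (M : Type).
Local Notation ptree := (ptree d M).

Fixpoint tiso_refl (t : ptree) : tiso t t :=
  let: PNode n x m cs := t in
  TIso n x m ((fix fiso_refl cs : fiso cs cs :=
    if cs is (a, s) :: cs' then FIso_cons a (tiso_refl s) (fiso_refl cs')
    else @FIso_nil d M) cs).

Lemma fiso_refl (cs : seq (mi d * ptree)) : fiso cs cs.
Proof.
elim: cs => [|[a s] cs IH]; first exact: FIso_nil.
exact: FIso_cons (tiso_refl s) IH.
Qed.

Lemma tiso_sym (s t : ptree) : tiso s t -> tiso t s.
Proof.
apply: (@tiso_fiso_ind d M (fun s t => tiso t s) (fun cs ds => fiso ds cs)).
- by move=> n x m cs ds _; apply: TIso.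
- exact: FIso_nil.
- by move=> a u v cs ds _ uv _; apply: FIso_cons.
- by move=> c1 c2 cs; apply: FIso_swap.
- by move=> cs ds es _ dc _ ed; apply: FIso_trans ed dc.
Qed.

Lemma tiso_trans (s t u : ptree) : tiso s t -> tiso t u -> tiso s u.
Proof.
case=> n x m cs ds st tu; inversion tu; subst.
by apply: TIso; apply: FIso_trans st _.
Qed.

Definition tisob (s t : ptree) : bool := `[< tiso s t >].

Lemma tisob_refl : reflexive tisob.
Proof. by move=> s; apply/asboolP/tiso_refl. Qed.

Lemma tisob_sym : symmetric tisob.
Proof. by move=> s t; apply/asboolP/asboolP; apply: tiso_sym. Qed.

Lemma tisob_trans : transitive tisob.
Proof.
move=> t s u /asboolP st /asboolP tu; apply/asboolP; exact: tiso_trans st tu.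
Qed.

Canonical tisob_equiv := EquivRel tisob tisob_refl tisob_sym tisob_trans.

Definition dtree : Type := {eq_quot tisob}.
HB.instance Definition _ := Choice.on dtree.
HB.instance Definition _ := EqQuotient.on dtree.

(* (a, t) stands for the planted tree I_a(t) *)
Local Notation planted := (mi d * dtree)%type.

Definition pdec (t : ptree) : mi d := let: PNode n _ _ _ := t in n.
Definition pmark (t : ptree) : M := let: PNode _ x _ _ := t in x.
Definition pnoise (t : ptree) : nat := let: PNode _ _ m _ := t in m.
Definition psons (t : ptree) : seq (mi d * ptree) :=
  let: PNode _ _ _ cs := t in cs.

(* A node is addressed by the path leading to it from the root: the j-th    *)
(* entry is the rank of the edge to follow at depth j.                      *)
Fixpoint nodes (t : ptree) : seq (seq nat) :=
  let: PNode _ _ _ cs := t in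
  [::] :: flatten [seq [seq ip.1 :: p | p <- ip.2]
                  | ip <- zip (iota 0 (size cs)) [seq nodes c.2 | c <- cs]].

Fixpoint subtree (v : seq nat) (t : ptree) : ptree :=
  if v is i :: v' then
    if onth (psons t) i is Some c then subtree v' c.2 else t
  else t.

Fixpoint modify (f : ptree -> ptree) (v : seq nat) (t : ptree) : ptree :=
  if v is i :: v' then
    let: PNode n x m cs := t in
    PNode n x m [seq if ic.1 == i then (ic.2.1, modify f v' ic.2.2) else ic.2
                | ic <- zip (iota 0 (size cs)) cs]
  else f t.

Definition raise (k : mi d) : seq nat -> ptree -> ptree :=
  modify (fun t => let: PNode n x m cs := t in PNode (n + k) x m cs).

(* only used when k is at most the decoration of the node *)
Definition lower (k : mi d) : seq nat -> ptree -> ptree :=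
  modify (fun t => let: PNode n x m cs := t in PNode (misub n k) x m cs).

Definition graft_at (s : ptree) (a : mi d) : seq nat -> ptree -> ptree :=
  modify (fun t => let: PNode n x m cs := t in PNode n x m ((a, s) :: cs)).

(* The tree with root decoration k, m noise edges at the root and branches  *)
(* I_{a_i}(s_i) for (a_i, s_i) in cs.                                       *)
Definition tnode (k : mi d) (x : M) (m : nat) (cs : seq planted) : dtree :=
  \pi_dtree (PNode k x m [seq (c.1, repr c.2) | c <- cs]).

Definition root_dec (t : dtree) : mi d := pdec (repr t).
Definition root_noise (t : dtree) : nat := pnoise (repr t).
Definition branches (t : dtree) : seq planted :=
  [seq (c.1, \pi_dtree c.2) | c <- psons (repr t)].

Lemma repr_tnode (k : mi d) (x : M) (m : nat) (cs : seq planted) :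
  exists2 ds, repr (tnode k x m cs) = PNode k x m ds
            & fiso [seq (c.1, repr c.2) | c <- cs] ds.
Proof.
have : repr (tnode k x m cs) = PNode k x m [seq (c.1, repr c.2) | c <- cs]
         %[mod dtree] by rewrite reprK.
move/esym/eqmodP/asboolP => h; inversion h; subst.
by exists ds.
Qed.

Lemma fiso_perm_eq (cs ds : seq (mi d * ptree)) : fiso cs ds ->
  perm_eq [seq (c.1, \pi_dtree c.2) | c <- cs]
          [seq (c.1, \pi_dtree c.2) | c <- ds].
Proof.
elim=> {cs ds} [|a s t cs ds st _ IH|c1 c2 cs|cs ds es _ cd _ de] //=.
- have -> : \pi_dtree s = \pi_dtree t by apply/eqmodP/asboolP.
  by rewrite perm_cons.
- by apply/permP => p /=; rewrite addnCA.
- exact: perm_trans cd de.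
Qed.

Lemma root_dec_tnode (k : mi d) (x : M) (m : nat) (cs : seq planted) :
  root_dec (tnode k x m cs) = k.
Proof. by have [ds e _] := repr_tnode k x m cs; rewrite /root_dec e. Qed.

Lemma root_noise_tnode (k : mi d) (x : M) (m : nat) (cs : seq planted) :
  root_noise (tnode k x m cs) = m.
Proof. by have [ds e _] := repr_tnode k x m cs; rewrite /root_noise e. Qed.

Lemma branches_tnode (k : mi d) (x : M) (m : nat) (cs : seq planted) :
  perm_eq (branches (tnode k x m cs)) cs.
Proof.
have [ds e h] := repr_tnode k x m cs; rewrite /branches e /= perm_sym.
have := fiso_perm_eq h; rewrite -map_comp.
by rewrite (@eq_map _ _ _ id) ?map_id // => -[a t] /=; rewrite reprK.
Qed.

End Trees.

Notation planted d M := (mi d * dtree d M)%type.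
Notation tree d := (dtree d unit).

Section TreeOperations.
Variables (R : fieldType) (d : nat).

Section Grafting.
Variable M : Type.
Local Notation dtree := (dtree d M).
Local Notation planted := (planted d M).

(* I_a, extended linearly, for a in N^{d+1} *)
Definition plant (a : mi d) : {malg R[dtree]} -> {malg R[planted]} :=
  lext (fun t => << (a, t) >>).

Definition up (i : 'I_d.+1) (t : dtree) : {malg R[dtree]} :=
  let t0 := repr t in
  \sum_(v <- nodes t0) << \pi_dtree (raise (mie i) v t0) >>.

(* Deformed grafting of s onto t. The sum over l in N^{d+1} is restricted   *)
(* to finitely many l, those left out having a zero binomial coefficient;   *)
(* the terms where a - l is not in N^{d+1} are 0.                           *)
Definition dgraft (a : mi d) (s t : dtree) : {malg R[dtree]} :=
  let s0 := repr s in let t0 := repr t in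
  \sum_(v <- nodes t0) let n := pdec (subtree v t0) in
    \sum_(l : box n | mile (unbox l) a)
      (mibin n (unbox l))%:R *:
        << \pi_dtree (graft_at s0 (misub a (unbox l)) v
                        (lower (unbox l) v t0)) >>.

Definition pgraft (x y : planted) : {malg R[planted]} :=
  plant y.1 (dgraft x.1 x.2 y.2).

(* Guin-Oudom extension; the commutative product x_1 ... x_n of planted     *)
(* trees is given by the sequence of its factors. The first argument is a   *)
(* bound on the number of factors.                                          *)
Fixpoint guin_oudom_rec (n : nat) (A : seq planted) (w : planted) :
    {malg R[planted]} :=
  match n, A with
  | n'.+1, x :: A' =>
      lext (pgraft x) (guin_oudom_rec n' A' w)
      - \sum_(j < size A')
          lext (fun y => guin_oudom_rec n' (set_nth x A' j y) w)
               (pgraft x (nth x A' j))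
  | _, _ => << w >>
  end.

Definition guin_oudom (A : seq planted) (w : planted) : {malg R[planted]} :=
  guin_oudom_rec (size A) A w.

End Grafting.

Fixpoint relabel (M N : Type) (f : M -> N) (t : ptree d M) : ptree d N :=
  let: PNode n x m cs := t in
  PNode n (f x) m [seq (c.1, relabel f c.2) | c <- cs].

Definition mark (M N : Type) (x : N) (t : dtree d M) : dtree d N :=
  \pi_(dtree d N) (relabel (fun=> x) (repr t)).

(* X^k prod_i I_{a_i}(s_i), for the sequence cs of the (a_i, s_i) *)
Definition XI (k : mi d) (cs : seq (planted d unit)) : tree d := tnode k tt 0 cs.

(* Sum over the families (k_v) with sum k, v ranging over the nodes marked  *)
(* true, of the trees obtained by adding k_v to the decoration of v; marks  *)
(* are then erased. A family is weighted by the number k! / prod_v k_v! of  *)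
(* ways of distributing the |k| unit increments among the nodes: with all   *)
(* weights 1 the product star2 below would not be associative.              *)
Definition raise_marked (k : mi d) (t : dtree d bool) : {malg R[tree d]} :=
  let t0 := repr t in
  let vs := [seq v <- nodes t0 | pmark (subtree v t0)] in
  \sum_(K : {ffun 'I_(size vs) -> box k} | \sum_j unbox (K j) == k)
    ((mifact k)%:R / (\prod_j mifact (unbox (K j)))%:R) *:
      << \pi_(tree d) (relabel (fun=> tt)
           (foldr (fun j u => raise (unbox (K j)) (nth [::] vs j) u) t0
                  (enum 'I_(size vs)))) >>.

(* For sigma = X^k prod_i I_{a_i}(s_i); the nodes of tau are marked true,   *)
(* those of sigma false. The planted tree I_0(tau) may be replaced by any   *)
(* other I_b(tau), see star2E.                                              *)
Definition star2 (sigma tau : tree d) : {malg R[tree d]} :=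
  lext (fun p => raise_marked (root_dec sigma) p.2)
       (guin_oudom [seq (c.1, mark false c.2) | c <- branches sigma]
                   (0, mark true tau)).

Lemma guin_oudom_root (M : Type) (A : seq (planted d M)) (b a : mi d)
    (t : dtree d M) :
  guin_oudom A (b, t) = lext (fun p => << (b, p.2) >>) (guin_oudom A (a, t)).
Proof.
rewrite /guin_oudom; move: (size A) => n.
elim: n A => [|n IH] [|x A] /=; rewrite ?lextU //.
rewrite lextB [X in _ = _ - X]lext_sum.
rewrite [X in _ = X - _]lext_comp.
rewrite IH.
rewrite [X in X - _ = _]lext_comp.
apply: (congr2 (fun u v => u - v)).
  apply: eq_lext => p; rewrite lextU /pgraft /= /plant lext_comp.
  by apply: eq_lext => u; rewrite lextU.
apply: eq_bigr => j _; rewrite [RHS]lext_comp; apply: eq_lext => y; exact: IH.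
Qed.

Lemma star2E (sigma tau : tree d) (b : mi d) :
  plant b (star2 sigma tau) =
  lext (fun p => plant p.1 (raise_marked (root_dec sigma) p.2))
       (guin_oudom [seq (c.1, mark false c.2) | c <- branches sigma]
                   (b, mark true tau)).
Proof.
rewrite (guin_oudom_root _ b 0) lext_comp /star2 /plant lext_comp.
by apply: eq_lext => p; rewrite lextU.
Qed.

End TreeOperations.

Section PostLie.
Variables (R : fieldType) (d : nat).

(* inl (a, t) stands for I_a(t), and inr i for X_i *)
Local Notation vbasis := (planted d unit + 'I_d.+1)%type.

Definition V : lmodType R := {malg R[vbasis]}.

Definition vI (w : planted d unit) : V := << inl w >>.
Definition vX (i : 'I_d.+1) : V := << inr i >>.

Definition bilext (f : vbasis -> vbasis -> V) (x y : V) : V :=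
  lext (fun b => lext (f b) y) x.

Definition tri : V -> V -> V :=
  bilext (fun x y => match x, y with
    | inr i, inl w => lext vI (plant w.1 (up R i w.2))
    | inl w, inl z => lext vI (pgraft R w z)
    | _, inr _ => 0
    end).

Definition IX_bracket (w : planted d unit) (i : 'I_d.+1) : V :=
  if (0 < w.1 i)%N then vI (misub w.1 (mie i), w.2) else 0.

Definition bracket0 : V -> V -> V :=
  bilext (fun x y => match x, y with
    | inl w, inr i => IX_bracket w i
    | inr i, inl w => - IX_bracket w i
    | inl _, inl _ | inr _, inr _ => 0
    end).

Definition U0 : algType R := uea bracket0.
Definition toU : V -> U0 := @uinj R V bracket0.

(* X_0^{k_0} ... X_d^{k_d} prod_i I_{a_i}(s_i) *)
Definition ordered_monomial (k : mi d) (cs : seq (planted d unit)) : U0 :=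
  (\prod_(i < d.+1) toU (vX i) ^+ k i) * \prod_(c <- cs) toU (vI c).

(* Identification of the tree X^k prod_i I_{a_i}(s_i) with the ordered      *)
(* monomial, extended linearly; only meaningful on combinations of trees    *)
(* without noise edge at the root.                                          *)
Definition tree_monomial (t : tree d) : U0 :=
  ordered_monomial (root_dec t) (branches t).
Definition tree_to_U : {malg R[tree d]} -> U0 := lext tree_monomial.

Lemma toU_vI_comm (w z : planted d unit) :
  toU (vI w) * toU (vI z) = toU (vI z) * toU (vI w).
Proof.
have [_ comm] := uinj_lie_map bracket0.
have := comm (vI w) (vI z); rewrite /bracket0 /bilext !lextU.
have [lin _] := uinj_lie_map bracket0.
have -> : uinj bracket0 0 = 0.
  by have := lin (-1) 0 0; rewrite scaler0 addr0 scaleN1r addNr.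
by move/esym/eqP; rewrite subr_eq0 => /eqP.
Qed.

Lemma tree_monomial_XI (k : mi d) (cs : seq (planted d unit)) :
  tree_monomial (XI k cs) = ordered_monomial k cs.
Proof.
rewrite /tree_monomial /ordered_monomial /XI root_dec_tnode; congr (_ * _).
have swap (s1 s2 : seq (planted d unit)) : perm_eq s1 s2 ->
    \prod_(c <- s1) toU (vI c) = \prod_(c <- s2) toU (vI c).
  elim: s1 s2 => [|w s1 IH] s2 h.
    by move: h; rewrite perm_sym => /perm_nilP ->.
  have ws2 : w \in s2 by rewrite -(perm_mem h) mem_head.
  case/splitPr: ws2 h => {}s2 s3 h.
  rewrite big_cat !big_cons /= (IH (s2 ++ s3)); last first.
    rewrite -(perm_cons w); apply: perm_trans h _.
    by rewrite (perm_catCA s2 [:: w] s3).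
  rewrite big_cat /= !mulrA; congr (_ * _).
  by apply: commr_prod => z _; apply: toU_vI_comm.
exact: swap (branches_tnode _ _ _ _).
Qed.

End PostLie.

(* Main.v *)
From HB Require Import structures.
Require Import Defs.
From mathcomp Require Import all_boot all_algebra.
From mathcomp Require Import finmap generic_quotient boolp reals.
From mathcomp.multinomials Require Import monalg.

Set Implicit Arguments.
Unset Strict Implicit.
Unset Printing Implicit Defensive.

Import GRing.Theory Num.Theory.
Local Open Scope ring_scope.
Local Open Scope quotient_scope.

(** Both identities say that a linear map S on the enveloping algebra is computed
    by the product of trees: S = [star T _ B] in the first one, S = [T _ y] in
    the second one. In both cases S obeys the recursion of Guin and Oudom
      S (x A) = L_x (S A) - S (x |> A),   x a generator I_a(sigma) or X_i,
    where L_x C is x C + x |> C in the first case and x |> C in the second one,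
    and where x |> _ acts on U as a derivation. Trees are embedded in U by a
    map Phi (ordered monomials, respectively planted trees), and L_x (Phi t) is
    the image under Phi of the deformed grafting onto t, or of the raising of
    all the nodes of t. The lemma [transfer] shows that these properties
    determine S on ordered monomials and force S sigma = Phi (sigma star_2 tau).

    On the side of trees, grafting and raising are both sums over the nodes of a
    tree of a modification depending on the decoration of the node
    ([local_op]). Mark the nodes of tau true and those of sigma false. Each
    operator then splits into a part acting on true nodes and a part acting on
    false nodes. Operators acting on true and on false nodes commute, except
    that the second kind also acts on what the first kind has grafted
    ([local_op_commutator]). Hence the false part, applied to trees sigma_i
    grafted on the true nodes of tau, is the derivation acting on the family
    (sigma_i) ([multi_graft_leibniz]): it is the term S (x |> A), and the
    recursion only leaves the true part. So the Guin-Oudom product is the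
    simultaneous grafting onto the nodes of tau, and multiplying by X_i on the
    left raises the nodes of tau only. The operators which raise the true nodes
    by k come from iterating the case of a unit increment, by Pascal's rule for
    multinomial coefficients ([multinomial_sum_mie]).

    On the side of the enveloping algebra, the recursion of [star] needs that
    the defining identity (xA) |> y = x |> (A |> y) - (x |> A) |> y extends from
    y in V to all of U ([ext_mulV_all]), which rests on A |> 1 = epsilon(A).
    Finally L_x (Phi t) is computed by moving a planted tree to the right of the
    powers of the X_i: the brackets [I_a(sigma), X_i] = I_{a-e_i}(sigma) produce
    the binomial terms of the deformed grafting at the root ([I_X_pow]). *)

(** * Linear extensions and derivations of lists *)

(** Sealed, so that unification does not unfold linear extensions down to the
    construction of free modules. *)
HB.lock Definition extend (R : fieldType) (X : choiceType) (W : lmodType R)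
  (f : X -> W) (u : {malg R[X]}) : W := lext f u.

Section Extend.
Variables (R : fieldType) (X : choiceType) (W : lmodType R).
Implicit Types (f g : X -> W) (u v : {malg R[X]}).

Lemma lextE f u : lext f u = extend f u.
Proof. by rewrite unlock. Qed.

Lemma extendE f u : extend f u = \sum_(x <- msupp u) u@_x *: f x.
Proof. by rewrite unlock. Qed.

Lemma extend_linear f : linear (extend f).
Proof. rewrite unlock; exact: lext_linear. Qed.

HB.instance Definition _ f :=
  GRing.isLinear.Build R {malg R[X]} W _ (extend f) (extend_linear f).

Lemma extendD f u v : extend f (u + v) = extend f u + extend f v.
Proof. exact: raddfD. Qed.

Lemma extendB f u v : extend f (u - v) = extend f u - extend f v.
Proof. exact: raddfB. Qed.

Lemma extendZ f c u : extend f (c *: u) = c *: extend f u.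
Proof. exact: linearZ. Qed.

Lemma extend0 f : extend f 0 = 0.
Proof. exact: raddf0. Qed.

Lemma extendU f x : extend f << x >> = f x.
Proof. rewrite unlock; exact: lextU. Qed.

Lemma eq_extend f g u : f =1 g -> extend f u = extend g u.
Proof. by move=> fg; rewrite !extendE; apply: eq_bigr => x _; rewrite fg. Qed.

Lemma extend_sum f (I : Type) (r : seq I) (P : pred I) (F : I -> {malg R[X]}) :
  extend f (\sum_(i <- r | P i) F i) = \sum_(i <- r | P i) extend f (F i).
Proof. exact: raddf_sum. Qed.

Lemma extend_fun0 u : extend (fun=> 0 : W) u = 0.
Proof. by rewrite extendE; apply: big1 => x _; rewrite scaler0. Qed.

Lemma extend_funD f g u :
  extend (fun x => f x + g x) u = extend f u + extend g u.
Proof.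
by rewrite (extendE f) (extendE g) extendE -big_split; apply: eq_bigr => x _; rewrite scalerDr.
Qed.

Lemma extend_funZ c f u : extend (fun x => c *: f x) u = c *: extend f u.
Proof.
rewrite extendE (extendE f) scaler_sumr.
by apply: eq_bigr => x _; rewrite !scalerA mulrC.
Qed.

Lemma extend_fun_sum (I : Type) (r : seq I) (P : pred I) (F : I -> X -> W) u :
  extend (fun x => \sum_(i <- r | P i) F i x) u =
  \sum_(i <- r | P i) extend (F i) u.
Proof.
rewrite extendE; under eq_bigr do rewrite scaler_sumr.
by rewrite exchange_big; apply: eq_bigr => i _ /=; rewrite extendE.
Qed.

Lemma eq_in_extend f g u : (forall x, u@_x != 0 -> f x = g x) ->
  extend f u = extend g u.
Proof.
move=> fg; rewrite !extendE big_seq [RHS]big_seq; apply: eq_bigr => x.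
by rewrite -mcoeff_neq0 => /fg ->.
Qed.

End Extend.

Lemma linear_extend (R : fieldType) (X : choiceType) (W W' : lmodType R)
    (h : W -> W') (f : X -> W) (u : {malg R[X]}) : linear h ->
  h (extend f u) = extend (fun x => h (f x)) u.
Proof.
move=> lh; have h0 : h 0 = 0.
  by have := lh (-1) 0 0; rewrite !scaleN1r !addNr.
rewrite extendE (extendE (fun x => h (f x))); elim: (enum_fset (msupp u)) => [|x s IH].
  by rewrite !big_nil.
by rewrite !big_cons lh IH.
Qed.

Lemma extend_comp (R : fieldType) (X Y : choiceType) (W : lmodType R)
    (g : Y -> W) (f : X -> {malg R[Y]}) u :
  extend g (extend f u) = extend (fun x => extend g (f x)) u.
Proof. by apply: linear_extend; apply: extend_linear. Qed.

Lemma extend_id (R : fieldType) (X : choiceType) (u : {malg R[X]}) :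
  extend (fun x => << x >>) u = u.
Proof.
rewrite [RHS]monalgE extendE; apply: eq_bigr => x _.
by apply/malgP => y; rewrite mcoeffZ !mcoeffU mulr_natr.
Qed.

Lemma extend_exchange (R : fieldType) (X Y : choiceType) (W : lmodType R)
    (f : X -> Y -> W) (u : {malg R[X]}) (v : {malg R[Y]}) :
  extend (fun x => extend (f x) v) u = extend (fun y => extend (f^~ y) u) v.
Proof.
rewrite !extendE.
transitivity (\sum_(x <- msupp u) \sum_(y <- msupp v) (u@_x * v@_y) *: f x y).
  apply: eq_bigr => x _; rewrite extendE scaler_sumr.
  by under eq_bigr do rewrite scalerA.
rewrite exchange_big; apply: eq_bigr => y _; rewrite extendE scaler_sumr.
by under [RHS]eq_bigr do rewrite scalerA mulrC.
Qed.

Lemma mcoeff_extend (R : fieldType) (X Y : choiceType) (f : X -> {malg R[Y]})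
    (u : {malg R[X]}) (y : Y) :
  (extend f u)@_y = \sum_(x <- msupp u) u@_x * (f x)@_y.
Proof.
rewrite extendE raddf_sum.
by apply: eq_bigr => x _; rewrite /= mcoeffZ.
Qed.

Lemma add_congr (V : zmodType) (x x' y y' : V) :
  x = x' -> y = y' -> x + y = x' + y'.
Proof. by move=> -> ->. Qed.

Lemma add4_swap (V : zmodType) (a b c e : V) :
  a + e + (c + b) = a + b + (c + e).
Proof. by rewrite (addrC c b) (addrACA a) (addrC e c). Qed.

Lemma add6_shuffle (V : zmodType) (a a' b b' c e : V) :
  a + a' + (b + b') + (c + e) = a + b + (e + c) + (a' + b').
Proof. by rewrite (addrACA a) (addrAC _ _ (c + e)) (addrC c e). Qed.

Section Leibniz.
Variables (R : fieldType).

(** The extension of [D] to lists as a derivation for concatenation; [h] is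
    applied to the entries which [D] leaves alone. *)
Fixpoint leibniz (X Y : choiceType) (h : X -> Y) (D : X -> {malg R[Y]})
    (s : seq X) : {malg R[seq Y]} :=
  if s is x :: s' then
    extend (fun y => << y :: map h s' >>) (D x)
    + extend (fun s'' => << h x :: s'' >>) (leibniz h D s')
  else 0.

Lemma extend_leibniz_cons (X Y : choiceType) (W : lmodType R)
    (K : seq Y -> W) (h : X -> Y) D x s :
  extend K (leibniz h D (x :: s)) =
  extend (fun y => K (y :: map h s)) (D x)
  + extend (fun s' => K (h x :: s')) (leibniz h D s).
Proof.
rewrite /= extendD !extend_comp; apply: add_congr.
  by apply: eq_extend => y; rewrite extendU.
by apply: eq_extend => s'; rewrite extendU.
Qed.

Lemma extend_leibniz_swap (X Y : choiceType) (W : lmodType R)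
    (K : seq Y -> W) (h : X -> Y) D x y s :
  (forall L L', perm_eq L L' -> K L = K L') ->
  extend K (leibniz h D [:: x, y & s]) = extend K (leibniz h D [:: y, x & s]).
Proof.
have swap z t L : perm_eq [:: z, t & L] [:: t, z & L].
  by apply/permP => p /=; rewrite addnCA.
move=> Kp; rewrite !extend_leibniz_cons addrCA.
apply: add_congr; last apply: add_congr.
- by apply: eq_extend => z; apply: Kp; apply: swap.
- by apply: eq_extend => z; apply: Kp; apply: swap.
by apply: eq_extend => L; apply: Kp; apply: swap.
Qed.

Lemma leibniz_map (X Y Z : choiceType) (g : Z -> X) (h : X -> Y) D s :
  leibniz h D (map g s) = leibniz (h \o g) (D \o g) s.
Proof.
elim: s => [|z s IH]; first by [].
by rewrite /= IH -map_comp.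
Qed.

Lemma eq_in_leibniz (X Y : choiceType) (h k : X -> Y) D D' (s : seq X) :
  {in s, h =1 k} -> {in s, D =1 D'} -> leibniz h D s = leibniz k D' s.
Proof.
elim: s => [|x s IH] hk DD'; first by [].
rewrite /=.
have hs : {in s, h =1 k} by move=> y ys; apply: hk; rewrite inE ys orbT.
have Ds : {in s, D =1 D'} by move=> y ys; apply: DD'; rewrite inE ys orbT.
rewrite (DD' x (mem_head x s)) (hk x (mem_head x s)) (IH hs Ds).
by have /eq_in_map -> := hs.
Qed.

Lemma leibniz_extend_map (X Y Z : choiceType) (g : Y -> Z) (h : X -> Y) D s :
  leibniz (g \o h) (fun x => extend (fun y => << g y >>) (D x)) s
  = extend (fun s' => << map g s' >>) (leibniz h D s).
Proof.
elim: s => [|x s IH] /=; first by rewrite extend0.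
rewrite {}IH extendD !extend_comp; apply: add_congr; apply: eq_extend => y.
  by rewrite !extendU /= map_comp.
by rewrite !extendU.
Qed.

Lemma leibniz0 (X Y : choiceType) (h : X -> Y) (D : X -> {malg R[Y]})
    (s : seq X) : {in s, forall x, D x = 0} -> leibniz h D s = 0.
Proof.
elim: s => [|x s IH] D0; first by [].
rewrite /= (D0 x (mem_head x s)) extend0 add0r IH ?extend0; first by [].
by move=> y ys; apply: D0; rewrite inE ys orbT.
Qed.

Lemma eq_size_leibniz (X Y : choiceType) (W : lmodType R) (F G : seq Y -> W)
    (h : X -> Y) D s :
  (forall s', size s' = size s -> F s' = G s') ->
  extend F (leibniz h D s) = extend G (leibniz h D s).
Proof.
elim: s F G => [|x s IH] F G FG; first by rewrite !extend0.
rewrite /=.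
rewrite !extendD !extend_comp; apply: add_congr.
  by apply: eq_extend => y; rewrite !extendU FG //= size_map.
by apply: IH => s' s'E; rewrite !extendU FG //= s'E.
Qed.

Section Same.
Variable X : choiceType.
Implicit Types (D : X -> {malg R[X]}) (s t : seq X).
Local Notation lz := (leibniz id).

Lemma leibniz_cat D s t :
  lz D (s ++ t) = extend (fun s' => << s' ++ t >>) (lz D s)
                + extend (fun t' => << s ++ t' >>) (lz D t).
Proof.
elim: s => [|x s IH] /=; first by rewrite extend0 add0r extend_id.
rewrite IH !map_id !extendD !extend_comp addrA; apply: add_congr; first apply: add_congr.
- by apply: eq_extend => y; rewrite !extendU.
- by apply: eq_extend => y; rewrite !extendU.
by apply: eq_extend => y; rewrite !extendU.
Qed.

(** The terms in which the two derivations act on different entries cancel. *)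
Lemma leibniz_commutator D1 D2 D3 s :
  {in s, forall x, extend D1 (D2 x) = extend D2 (D1 x) + D3 x} ->
  extend (lz D1) (lz D2 s) = extend (lz D2) (lz D1 s) + lz D3 s.
Proof.
elim: s => [|x s IH] comm /=; first by rewrite !extend0 addr0.
pose A D D' := extend (fun y => << y :: s >>) (extend D (D' x)) : {malg R[seq X]}.
pose B D D' := extend (fun s' => << x :: s' >>) (extend (lz D) (lz D' s))
  : {malg R[seq X]}.
pose C D D' := extend (fun s' => extend (fun y => << y :: s' >>) (D x)) (lz D' s)
  : {malg R[seq X]}.
have key D D' : extend (lz D) (lz D' (x :: s)) = A D D' + B D D' + (C D D' + C D' D).
  rewrite /= map_id extendD !extend_comp.
  rewrite -add4_swap; apply: add_congr.
    rewrite /A /C extend_comp extend_exchange -extend_funD.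
    by apply: eq_extend => y; rewrite extendU /= map_id.
  rewrite /B /C extend_comp -extend_funD.
  by apply: eq_extend => s'; rewrite extendU /= map_id.
have comms : {in s, forall y, extend D1 (D2 y) = extend D2 (D1 y) + D3 y}.
  by move=> y ys; apply: comm; rewrite inE ys orbT.
have -> := key D1 D2; have -> := key D2 D1.
have -> : A D1 D2 = A D2 D1 + extend (fun y => << y :: s >>) (D3 x).
  by rewrite /A (comm x (mem_head x s)) extendD.
have -> : B D1 D2 = B D2 D1 + extend (fun s' => << x :: s' >>) (lz D3 s).
  by rewrite /B (IH comms) extendD.
rewrite map_id; exact: add6_shuffle.
Qed.

(** The form in which the derivation occurs in the Guin-Oudom recursion. *)
Lemma leibniz_nth (W : lmodType R) (F : seq X -> W) D x0 s :
  \sum_(j < size s) extend (fun y => F (set_nth x0 s j y)) (D (nth x0 s j))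
  = extend F (lz D s).
Proof.
elim: s F => [|x s IH] F; first by rewrite big_ord0 extend0.
rewrite big_ord_recl /= extendD !extend_comp map_id; apply: add_congr.
  by apply: eq_extend => y; rewrite extendU.
rewrite (IH (fun s' => F (x :: s'))).
by apply: eq_extend => s'; rewrite extendU.
Qed.

End Same.
End Leibniz.

(** * Planar representatives of decorated trees *)

Section PlanarTrees.
Variables (d : nat) (M : Type).
Local Notation ptree := (ptree d M).
Local Notation dtree := (dtree d M).
Implicit Types (t : ptree) (c : mi d * ptree) (cs : seq (mi d * ptree)).

(** Induction reaching the subtrees that sit inside the list of branches. *)
Lemma ptree_nested_ind (P : ptree -> Prop) :
  (forall n x m cs, (forall j, (j < size cs)%N ->
     forall c, onth cs j = Some c -> P c.2) -> P (PNode n x m cs)) ->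
  forall t : ptree, P t.
Proof.
move=> IH; fix rec 1 => -[n x m cs]; apply: IH.
elim: cs => [|c cs IHcs].
  by move=> {rec} j.
case=> [|j] jcs c' /= h; last exact: (IHcs j jcs c' h).
case: h => <-; exact: rec.
Qed.

Definition to_planted c : planted d M := (c.1, \pi_dtree c.2).
Definition of_planted (w : planted d M) : mi d * ptree := (w.1, repr w.2).

Lemma of_plantedK : cancel of_planted to_planted.
Proof. by case=> a t; rewrite /to_planted /= reprK. Qed.

Lemma fiso_repr cs : fiso cs [seq of_planted (to_planted c) | c <- cs].
Proof.
elim: cs => [|[a t] cs IH]; first exact: FIso_nil.
apply: FIso_cons IH.
have : t = repr (\pi_dtree t) %[mod dtree] by rewrite reprK.
by move/eqmodP/asboolP.
Qed.

Lemma pi_PNode n x m cs :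
  \pi_dtree (PNode n x m cs) = tnode n x m (map to_planted cs).
Proof.
apply/eqmodP/asboolP; apply: TIso; rewrite -map_comp; exact: fiso_repr.
Qed.

Lemma perm_fiso cs ds : perm_eq cs ds -> fiso cs ds.
Proof.
have cat_cons c ds1 ds2 : fiso (c :: ds1 ++ ds2) (ds1 ++ c :: ds2).
  elim: ds1 => [|c' ds1 IH] /=; first exact: fiso_refl.
  apply: FIso_trans (FIso_swap _ _ _) _.
  case: c' => a t; exact: FIso_cons (tiso_refl t) IH.
elim: cs ds => [|c cs IH] ds h.
  by move: h; rewrite perm_sym => /perm_nilP ->; exact: FIso_nil.
have cds : c \in ds by rewrite -(perm_mem h) mem_head.
case/splitPr: cds h => ds1 ds2 h; apply: FIso_trans (cat_cons c ds1 ds2).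
case: c h => a t h; apply: FIso_cons (tiso_refl t) _; apply: IH.
by move: h; rewrite perm_sym (perm_catCA ds1 [:: (a, t)]) perm_cons perm_sym.
Qed.

Lemma perm_tnode n x m (L L' : seq (planted d M)) :
  perm_eq L L' -> tnode n x m L = tnode n x m L'.
Proof.
move=> h; apply/eqmodP/asboolP; apply: TIso; apply: perm_fiso.
exact: perm_map h.
Qed.

Lemma dtree_ind (P : dtree -> Prop) :
  (forall n x m L, {in L, forall w, P w.2} -> P (tnode n x m L)) ->
  forall t : dtree, P t.
Proof.
move=> IH t; rewrite -(reprK t); elim/ptree_nested_ind: (repr t) => n x m cs H.
rewrite pi_PNode; apply: IH => w /mapP [c ccs ->] /=.
have [j jcs <-] := nthP c ccs; apply: (H j jcs).
by rewrite onthE (nth_map c).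
Qed.

Lemma map_at_index (T : Type) (F : T -> T) k (s1 : seq T) x s2 :
  [seq if ic.1 == (k + size s1)%N then F ic.2 else ic.2
     | ic <- zip (iota k (size (s1 ++ x :: s2))) (s1 ++ x :: s2)]
  = s1 ++ F x :: s2.
Proof.
have below s k' j : (j < k')%N ->
    [seq if ic.1 == j then F ic.2 else ic.2 | ic <- zip (iota k' (size s)) s]
    = s.
  elim: s k' => [|y s IH] k' //= jk'; rewrite (gtn_eqF jk') IH //.
  exact: ltnW.
elim: s1 k => [|y s1 IH] k /=; first by rewrite addn0 eqxx below.
by rewrite -addSnnS IH ltn_eqF // addSn ltnS leq_addr.
Qed.

Lemma modify_cons f n x m cs1 c cs2 v :
  modify f (size cs1 :: v) (PNode n x m (cs1 ++ c :: cs2)) =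
  PNode n x m (cs1 ++ (c.1, modify f v c.2) :: cs2).
Proof.
rewrite /=; congr PNode.
by rewrite -(map_at_index (fun c => (c.1, modify f v c.2)) 0).
Qed.

Lemma subtree_cons n x m cs1 c cs2 v :
  subtree (size cs1 :: v) (PNode n x m (cs1 ++ c :: cs2)) = subtree v c.2.
Proof. by rewrite /= onthE map_cat nth_cat size_map ltnn subnn. Qed.

Lemma sum_nodes (W : zmodType) (H : seq nat -> W) (Q : pred (seq nat))
    n x m cs :
  \sum_(v <- nodes (PNode n x m cs) | Q v) H v =
  (if Q [::] then H [::] else 0) +
  \sum_(jc <- zip (iota 0 (size cs)) cs)
     \sum_(v <- nodes jc.2.2 | Q (jc.1 :: v)) H (jc.1 :: v).
Proof.
rewrite /= big_cons.
suff -> : \sum_(v <- flatten [seq [seq ip.1 :: p | p <- ip.2]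
                  | ip <- zip (iota 0 (size cs)) [seq nodes c.2 | c <- cs]]
            | Q v) H v =
  \sum_(jc <- zip (iota 0 (size cs)) cs)
     \sum_(v <- nodes jc.2.2 | Q (jc.1 :: v)) H (jc.1 :: v).
  by case: ifP => _; rewrite ?add0r.
elim: cs 0%N => [|c cs IH] k /=; first by rewrite !big_nil.
by rewrite big_cat big_cons IH big_map.
Qed.

Lemma eq_modify f g v t :
  f (subtree v t) = g (subtree v t) -> modify f v t = modify g v t.
Proof.
elim: v t => [|i v IH] [n x m cs] //= fg; congr PNode.
have : forall j c, (j, c) \in zip (iota 0 (size cs)) cs -> onth cs j = Some c.
  move=> j c /(nthP (j, c)) [k]; rewrite size_zip size_iota minnn => kc.
  rewrite nth_zip ?size_iota // nth_iota // add0n => -[<- <-].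
  by rewrite onthE (nth_map c).
elim: (zip _ _) => [|[j c] s IHs] //= H; congr (_ :: _); last first.
  by apply: IHs => k e es; apply: H; rewrite inE es orbT.
case: eqP => // ji; congr (_, _); apply: IH.
by move: fg; rewrite -ji (H j c) ?mem_head.
Qed.

Lemma modify_modify f g v t :
  modify f v (modify g v t) = modify (fun u => f (g u)) v t.
Proof.
elim: v t => [|i v IH] [n x m cs] //=; congr PNode.
elim: cs 0%N => [|c cs IHcs] k //=; congr (_ :: _); last first.
  by rewrite -IHcs; congr map; congr zip; rewrite size_map size_zip size_iota minnn.
by case: eqP => //= _; rewrite IH.
Qed.

End PlanarTrees.

(** * Local operators on trees *)

Section LocalOperators.
Variables (R : fieldType) (d : nat).

Definition planting (M : Type) (a : mi d) (u : {malg R[dtree d M]}) :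
    {malg R[planted d M]} :=
  extend (fun t => << (a, t) >>) u.

Definition rewrite_root (M : Type) (p : mi d * seq (planted d M))
    (t : ptree d M) : ptree d M :=
  let: PNode n x m cs := t in PNode p.1 x m (map (@of_planted d M) p.2 ++ cs).

End LocalOperators.

(** A rule associates with the decoration of a node a combination of pairs made
    of a new decoration for this node and a list of new branches. *)
Notation rule R d M := (mi d -> {malg R[(mi d * seq (planted d M))%type]}).

Definition planar_local (R : fieldType) (d : nat) (M : Type) (P : pred M)
    (phi : rule R d M) (t : ptree d M) : {malg R[dtree d M]} :=
  \sum_(v <- nodes t | P (pmark (subtree v t)))
    extend (fun p => << \pi_(dtree d M) (modify (rewrite_root p) v t) >>)
           (phi (pdec (subtree v t))).

(** The common form of [up] and [dgraft]: a rule is applied at each of the nodes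
    whose mark satisfies [P]. *)
HB.lock Definition local_op (R : fieldType) (d : nat) (M : Type) (P : pred M)
    (phi : rule R d M) (t : dtree d M) : {malg R[dtree d M]} :=
  planar_local P phi (repr t).

Section LocalOperatorTheory.
Variables (R : fieldType) (d : nat) (M : Type).
Local Notation ptree := (ptree d M).
Local Notation dtree := (dtree d M).
Local Notation planted := (planted d M).
Implicit Types (P : pred M) (phi psi : rule R d M) (L : seq planted).

Definition local_op_planted P phi (w : planted) : {malg R[planted]} :=
  planting w.1 (local_op P phi w.2).

Definition root_op P phi n x m L : {malg R[dtree]} :=
  if P x then extend (fun p => << tnode p.1 x m (p.2 ++ L) >>) (phi n) else 0.

Lemma planar_local_PNode P phi n x m (cs : seq (mi d * ptree)) :
  planar_local P phi (PNode n x m cs) =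
  root_op P phi n x m (map (@to_planted d M) cs) +
  extend (fun L => << tnode n x m L >>)
    (leibniz (@to_planted d M) (fun c => planting c.1 (planar_local P phi c.2)) cs).
Proof.
rewrite /planar_local sum_nodes; apply: add_congr.
  rewrite /root_op /=; case: (P x); last by [].
  apply: eq_extend => p; rewrite pi_PNode map_cat -map_comp.
  by rewrite (eq_map (@of_plantedK d M)) map_id.
pose F cs1 cs2 := extend (fun L => << tnode n x m (map (@to_planted d M) cs1 ++ L) >>)
  (leibniz (@to_planted d M)
     (fun c => planting c.1 (planar_local P phi c.2)) cs2) : {malg R[dtree]}.
transitivity (F [::] cs); last by [].
suff main cs1 cs2 :
  \sum_(jc <- zip (iota (size cs1) (size cs2)) cs2)
    \sum_(v <- nodes jc.2.2
        | P (pmark (subtree (jc.1 :: v) (PNode n x m (cs1 ++ cs2)))))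
      extend (fun p => << \pi_dtree (modify (rewrite_root p) (jc.1 :: v)
                                     (PNode n x m (cs1 ++ cs2))) >>)
        (phi (pdec (subtree (jc.1 :: v) (PNode n x m (cs1 ++ cs2)))))
  = F cs1 cs2 by exact: (main [::] cs).
elim: cs2 cs1 => [|c cs2 IH] cs1; first by rewrite big_nil /F extend0.
rewrite [zip _ _]/= big_cons /F [leibniz _ _ (c :: _)]/= extendD; apply: add_congr.
  rewrite extend_comp /planting extend_comp /planar_local extend_sum.
  apply: eq_big => [v|v _]; first by rewrite subtree_cons.
  rewrite subtree_cons extend_comp; apply: eq_extend => p.
  rewrite !extendU modify_cons pi_PNode map_cat; by [].
have := IH (rcons cs1 c); rewrite /F size_rcons cat_rcons => ->.
rewrite extend_comp; apply: eq_extend => L.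
by rewrite extendU map_rcons cat_rcons.
Qed.

(** An isomorphism permutes the terms of the sum over the branches, at every
    level; the continuation [K] follows the position inside the whole tree. *)
Lemma planar_local_tiso P phi (s t : ptree) : tiso s t ->
  planar_local P phi s = planar_local P phi t.
Proof.
pose D (c : mi d * ptree) := planting c.1 (planar_local P phi c.2).
apply: (@tiso_fiso_ind d M
  (fun s t => planar_local P phi s = planar_local P phi t)
  (fun cs ds => forall K : seq planted -> {malg R[dtree]},
     (forall L L', perm_eq L L' -> K L = K L') ->
     extend K (leibniz (@to_planted d M) D cs)
     = extend K (leibniz (@to_planted d M) D ds))).
- move=> n x m cs ds h IH; rewrite !planar_local_PNode.
  have hp := fiso_perm_eq h; apply: add_congr.
    rewrite /root_op; case: (P x); last by [].
    apply: eq_extend => p; congr mkmalgU; apply: perm_tnode.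
    by rewrite perm_cat2l.
  by apply: IH => L L' LL'; rewrite (perm_tnode _ _ _ LL').
- move=> K _; exact: erefl.
- move=> a u v cs ds uv Duv h IH K Kp; rewrite !extend_leibniz_cons.
  have -> : to_planted (a, u) = to_planted (a, v).
    by rewrite /to_planted /=; congr (_, _); apply/eqmodP/asboolP.
  apply: add_congr; last first.
    by apply: IH => L L' LL'; apply: Kp; rewrite perm_cons.
  rewrite /D /= Duv; apply: eq_extend => w; apply: Kp.
  by rewrite perm_cons; apply: fiso_perm_eq.
- by move=> c1 c2 cs K Kp; apply: extend_leibniz_swap.
- by move=> cs ds es _ IH1 _ IH2 K Kp; rewrite IH1 ?IH2.
Qed.

Lemma local_op_pi P phi (t : ptree) :
  local_op P phi (\pi_dtree t) = planar_local P phi t.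
Proof.
rewrite local_op.unlock; apply: planar_local_tiso.
have : repr (\pi_dtree t) = t %[mod dtree] by rewrite reprK.
by move/eqmodP/asboolP.
Qed.

(** A local operator acts at the root or as a derivation on the branches: all
    the properties below are inductions along this identity. *)
Lemma local_op_tnode P phi n x m L :
  local_op P phi (tnode n x m L) =
  root_op P phi n x m L +
  extend (fun L' => << tnode n x m L' >>)
    (leibniz id (local_op_planted P phi) L).
Proof.
rewrite /tnode local_op_pi planar_local_PNode -map_comp.
rewrite (eq_map (@of_plantedK d M)) map_id; apply: add_congr; first by [].
rewrite leibniz_map; congr (extend _ _).
by apply: eq_in_leibniz => w _; [exact: of_plantedK | by rewrite /local_op_planted local_op.unlock].
Qed.

End LocalOperatorTheory.

Section LocalOperatorLaws.
Variables (R : fieldType) (d : nat) (M : Type).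
Local Notation dtree := (dtree d M).
Local Notation planted := (planted d M).
Implicit Types (P Q : pred M) (phi psi : rule R d M) (L : seq planted).
Implicit Types (w : planted).

Lemma local_op_split P phi (t : dtree) :
  local_op predT phi t = local_op P phi t + local_op (predC P) phi t.
Proof.
rewrite local_op.unlock /planar_local.
exact: (bigID (fun v => P (pmark (subtree v (repr t))))).
Qed.

Lemma local_op_extend (X : choiceType) P (psi : X -> rule R d M) u (t : dtree) :
  local_op P (fun n => extend (fun x => psi x n) u) t =
  extend (fun x => local_op P (psi x) t) u.
Proof.
rewrite local_op.unlock /planar_local extend_fun_sum; apply: eq_bigr => v _.
by rewrite extend_comp.
Qed.

Lemma eq_local_op P phi psi (t : dtree) : phi =1 psi ->
  local_op P phi t = local_op P psi t.
Proof.
move=> e; rewrite local_op.unlock /planar_local.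
by apply: eq_bigr => v _; rewrite e.
Qed.

Lemma planting_comp (a : mi d) (f : dtree -> {malg R[dtree]}) u :
  extend (fun v : planted => planting v.1 (f v.2)) (planting a u)
  = planting a (extend f u).
Proof.
rewrite /planting !extend_comp; apply: eq_extend => t; by rewrite extendU.
Qed.

(** The action of a local operator on the branches which a rule creates. *)
Definition act_on_rule P phi psi : rule R d M := fun n =>
  extend (fun p => extend (fun L => << (p.1, L) >>)
                     (leibniz id (local_op_planted P phi) p.2)) (psi n).

(** After a rule has been applied at a root which is left alone by [P], the
    operator acts on the new and on the old branches. *)
Lemma local_op_root_op P Q phi psi n x m L : ~~ P x ->
  extend (local_op P phi) (root_op Q psi n x m L) =
  root_op Q (act_on_rule P phi psi) n x m L +
  extend (fun L' => root_op Q psi n x m L')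
    (leibniz id (local_op_planted P phi) L).
Proof.
move=> /negbTE Px; rewrite /root_op; case: (Q x); last first.
  by rewrite extend0 extend_fun0 addr0.
rewrite [X in _ = _ + X]extend_exchange /act_on_rule !extend_comp -extend_funD.
apply: eq_extend => p; rewrite extendU local_op_tnode /root_op Px add0r.
rewrite leibniz_cat extendD !extend_comp; apply: add_congr.
  by apply: eq_extend => L'; rewrite !extendU.
by apply: eq_extend => L'; rewrite !extendU.
Qed.

(** Acting at two disjoint families of nodes: the operators commute, except
    that the first one also acts on what the second one has grafted. *)
Lemma local_op_commutator P Q phi psi (t : dtree) :
  (forall x, ~~ (P x && Q x)) ->
  (forall n p, (phi n)@_p != 0 -> {in p.2, forall w, local_op Q psi w.2 = 0}) ->
  extend (local_op P phi) (local_op Q psi t) =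
  extend (local_op Q psi) (local_op P phi t)
  + local_op Q (act_on_rule P phi psi) t.
Proof.
move=> PQ phiQ; elim/dtree_ind: t => n x m L IH.
have phi0 k : act_on_rule Q psi phi k = 0.
  rewrite /act_on_rule -[RHS](extend_fun0 _ (phi k)); apply: eq_in_extend => p pk.
  rewrite leibniz0 ?extend0 // => w wp.
  by rewrite /local_op_planted (phiQ k p pk w wp) /planting extend0.
(* At the root, at most one of the two operators applies its rule. *)
have root : extend (local_op P phi) (root_op Q psi n x m L) +
    extend (fun L' => root_op P phi n x m L')
      (leibniz id (local_op_planted Q psi) L) =
  extend (local_op Q psi) (root_op P phi n x m L) +
    extend (fun L' => root_op Q psi n x m L')
      (leibniz id (local_op_planted P phi) L) +
  root_op Q (act_on_rule P phi psi) n x m L.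
  have [Px|Px] := boolP (P x); last first.
    rewrite (@local_op_root_op P Q phi psi n x m L Px).
    have P0 L' : root_op P phi n x m L' = 0 by rewrite /root_op (negbTE Px).
    rewrite (eq_extend _ P0) extend_fun0 addr0 P0 extend0 add0r.
    exact: addrC.
  have Qx : ~~ Q x by move: (PQ x); rewrite Px.
  have Q0 psi' L' : root_op Q psi' n x m L' = 0 by rewrite /root_op (negbTE Qx).
  rewrite (@local_op_root_op Q P psi phi n x m L Qx) (eq_extend _ (Q0 psi)) extend_fun0 !Q0 extend0.
  have -> : root_op P (act_on_rule Q psi phi) n x m L = 0.
    by rewrite /root_op Px phi0 extend0.
  by rewrite !add0r !addr0.
rewrite !local_op_tnode !extendD !extend_comp.
(* On the branches, both operators are derivations. *)
pose C P1 Q1 phi1 psi1 := extend (fun L' => << tnode n x m L' >>)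
  (extend (leibniz id (local_op_planted P1 phi1))
    (leibniz id (local_op_planted Q1 psi1) L)) : {malg R[dtree]}.
have tn P1 Q1 phi1 psi1 :
    extend (fun L' => extend (local_op P1 phi1) << tnode n x m L' >>)
      (leibniz id (local_op_planted Q1 psi1) L) =
    extend (fun L' => root_op P1 phi1 n x m L')
      (leibniz id (local_op_planted Q1 psi1) L) + C P1 Q1 phi1 psi1.
  rewrite /C extend_comp -extend_funD; apply: eq_extend => L'.
  by rewrite extendU local_op_tnode.
rewrite !tn !addrA root.
have -> : C P Q phi psi = C Q P psi phi + extend (fun L' => << tnode n x m L' >>)
    (leibniz id (local_op_planted Q (act_on_rule P phi psi)) L).
  rewrite /C -extendD; congr (extend _ _); apply: leibniz_commutator => w wL.
  rewrite /local_op_planted !planting_comp IH //; exact: raddfD.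
rewrite addrA; apply: add_congr; last by [].
exact: addrAC.
Qed.

End LocalOperatorLaws.

(** * Marks, and the rules of grafting and raising *)

Section Marks.
Variables (R : fieldType) (d : nat).

Definition mark_planted (M N : Type) (y : N) (w : planted d M) : planted d N :=
  (w.1, mark y w.2).

Definition mark_rule (M N : Type) (y : N) (phi : rule R d M) : rule R d N :=
  fun n => extend (fun p => << (p.1, map (mark_planted y) p.2) >>) (phi n).

Lemma tiso_relabel (M N : Type) (f : M -> N) (s t : ptree d M) :
  tiso s t -> tiso (relabel f s) (relabel f t).
Proof.
apply: (@tiso_fiso_ind d M (fun s t => tiso (relabel f s) (relabel f t))
  (fun cs ds => fiso [seq (c.1, relabel f c.2) | c <- cs]
                     [seq (c.1, relabel f c.2) | c <- ds])).
- by move=> n x m cs ds _ h; apply: TIso.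
- exact: FIso_nil.
- by move=> a u v cs ds _ uv _ h; apply: FIso_cons.
- by move=> c1 c2 cs; apply: FIso_swap.
- by move=> cs ds es _ h1 _ h2; apply: FIso_trans h1 h2.
Qed.

Lemma mark_pi (M N : Type) (y : N) (t : ptree d M) :
  mark y (\pi_(dtree d M) t) = \pi_(dtree d N) (relabel (fun=> y) t).
Proof.
apply/eqmodP/asboolP; apply: tiso_relabel.
have : repr (\pi_(dtree d M) t) = t %[mod dtree d M] by rewrite reprK.
by move/eqmodP/asboolP.
Qed.

Lemma mark_tnode (M N : Type) (y : N) n (x : M) m (L : seq (planted d M)) :
  mark y (tnode n x m L) = tnode n y m (map (mark_planted y) L).
Proof.
by rewrite {1}/tnode mark_pi /= pi_PNode -!map_comp.
Qed.

Lemma mark_mark (M N N' : Type) (z : N) (y : N') (t : dtree d M) :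
  mark y (mark z t) = mark y t.
Proof.
elim/dtree_ind: t => n x m L IH; rewrite !mark_tnode -map_comp.
congr tnode; apply/eq_in_map => w wL; rewrite /mark_planted /=.
by rewrite (IH w wL).
Qed.

Lemma mark_tt (t : tree d) : mark tt t = t.
Proof.
elim/dtree_ind: t => n [] m L IH; rewrite mark_tnode; congr tnode.
rewrite -[RHS]map_id; apply/eq_in_map => -[a t] wL; rewrite /mark_planted.
by rewrite (IH _ wL).
Qed.

Lemma local_op_mark0 (M N : Type) (P : pred N) (phi : rule R d N) (y : N)
    (t : dtree d M) : ~~ P y -> local_op P phi (mark y t) = 0.
Proof.
move=> /negbTE Py; elim/dtree_ind: t => n x m L IH.
rewrite mark_tnode local_op_tnode /root_op Py add0r leibniz0 ?extend0 // => w.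
case/mapP => v vL ->.
by rewrite /local_op_planted /mark_planted (IH v vL) /planting extend0.
Qed.

(** If all nodes are treated alike, marking them the same way is harmless. *)
Lemma local_op_mark (M N : Type) (y : N) (phi : rule R d M) (t : dtree d M) :
  local_op predT (mark_rule y phi) (mark y t) =
  extend (fun u => << mark y u >>) (local_op predT phi t).
Proof.
elim/dtree_ind: t => n x m L IH.
rewrite mark_tnode !local_op_tnode extendD extend_comp; apply: add_congr.
  rewrite /root_op /= /mark_rule !extend_comp; apply: eq_extend => p.
  by rewrite !extendU mark_tnode map_cat.
transitivity (extend (fun L' => << tnode n y m L' >>)
  (extend (fun L' => << map (mark_planted y) L' >>)
    (leibniz id (local_op_planted predT phi) L)) : {malg R[dtree d N]}).
  rewrite -leibniz_extend_map leibniz_map; congr (extend _ _).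
  apply: eq_in_leibniz => w wL; first by [].
  rewrite /= /local_op_planted /mark_planted (IH w wL) /planting !extend_comp.
  by apply: eq_extend => u; rewrite !extendU.
rewrite extend_comp; apply: eq_extend => L'.
by rewrite !extendU mark_tnode.
Qed.

End Marks.

Section Rules.
Variables (R : fieldType) (d : nat) (M : Type).

Definition graft_rule (a : mi d) (s : dtree d M) : rule R d M := fun n =>
  \sum_(l : box n | mile (unbox l) a)
     (mibin n (unbox l))%:R *:
       << (misub n (unbox l), [:: (misub a (unbox l), s)]) >>.

Definition raise_rule (i : 'I_d.+1) : rule R d M :=
  fun n => << (n + mie i, [::]) >>.

Lemma dgraftE a s t : dgraft R a s t = local_op predT (graft_rule a s) t.
Proof.
rewrite local_op.unlock /planar_local /dgraft; apply: eq_bigr => v _.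
rewrite /graft_rule extend_sum; apply: eq_bigr => l _.
rewrite extendZ extendU; congr (_ *: << _ >>); congr (\pi_(dtree d M) _).
rewrite /graft_at /lower modify_modify; apply: eq_modify.
by move: (unbox l) => k /=; case: (subtree v (repr t)).
Qed.

Lemma upE i (t : dtree d M) : up R i t = local_op predT (raise_rule i) t.
Proof.
rewrite local_op.unlock /planar_local /up; apply: eq_bigr => v _.
rewrite extendU; congr << _ >>; congr (\pi_(dtree d M) _).
apply: eq_modify; by case: (subtree v (repr t)).
Qed.

Lemma plantE a (u : {malg R[dtree d M]}) : plant a u = planting a u.
Proof. by rewrite /plant lextE. Qed.

Lemma pgraftE (w z : planted d M) :
  pgraft R w z = local_op_planted predT (graft_rule w.1 w.2) z.
Proof. by rewrite /pgraft plantE dgraftE. Qed.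

End Rules.

Lemma mark_graft_rule (R : fieldType) (d : nat) (M N : Type) (y : N) (a : mi d)
    (s : dtree d M) :
  mark_rule y (graft_rule R a s) =1 graft_rule R a (mark y s).
Proof.
move=> n; rewrite /mark_rule /graft_rule extend_sum; apply: eq_bigr => l _.
by rewrite extendZ extendU.
Qed.

Lemma mark_raise_rule (R : fieldType) (d : nat) (M N : Type) (y : N)
    (i : 'I_d.+1) :
  mark_rule y (@raise_rule R d M i) =1 @raise_rule R d N i.
Proof. by move=> n; rewrite /mark_rule /raise_rule extendU. Qed.

Lemma act_on_raise_rule (R : fieldType) (d : nat) (M : Type) (P : pred M)
    (phi : rule R d M) (i : 'I_d.+1) n :
  act_on_rule P phi (@raise_rule R d M i) n = 0.
Proof. by rewrite /act_on_rule /raise_rule extendU /= extend0. Qed.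

Lemma act_on_graft_rule (R : fieldType) (d : nat) (M : Type) (P : pred M)
    (phi : rule R d M) (a : mi d) (s : dtree d M) n :
  act_on_rule P phi (graft_rule R a s) n =
  extend (fun u => graft_rule R a u n) (local_op P phi s).
Proof.
rewrite /act_on_rule /graft_rule extend_sum extend_fun_sum.
apply: eq_bigr => l _; rewrite extendZ extendU extend_funZ; congr (_ *: _).
rewrite extend_leibniz_cons /= extend0 addr0 /local_op_planted /planting.
by rewrite extend_comp; apply: eq_extend => u; rewrite extendU.
Qed.

(** * The Guin-Oudom product as a simultaneous grafting *)

Lemma extend_supp (R : fieldType) (X Y : choiceType) (f : X -> {malg R[Y]})
    (u : {malg R[X]}) (y : Y) :
  (extend f u)@_y != 0 -> exists x, (f x)@_y != 0.
Proof.
move=> uy; apply: contrapT => nx; move/eqP: uy; apply.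
rewrite mcoeff_extend big1 // => x _.
have -> : (f x)@_y = 0 by apply/eqP; apply: contra_notT nx => fx; exists x.
exact: mulr0.
Qed.

Section MultiGraft.
Variables (R : fieldType) (d : nat).
Local Notation planted := (planted d unit).
Local Notation btree := (dtree d bool).
Implicit Types (tau : tree d) (cs : seq planted) (phi : rule R d unit).

Lemma local_op_planted_mark (M N : Type) (y : N) (phi : rule R d M)
    (w : Defs.planted d M) :
  local_op_planted predT (mark_rule y phi) (mark_planted y w) =
  extend (fun v => << mark_planted y v >>) (local_op_planted predT phi w).
Proof.
rewrite /local_op_planted local_op_mark /planting !extend_comp.
by apply: eq_extend => u; rewrite !extendU.
Qed.

Definition graft_on_true (c : planted) : btree -> {malg R[btree]} :=
  local_op id (graft_rule R c.1 (mark false c.2)).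

(** The members of [cs] are grafted one by one, but their nodes are marked false
    and [graft_on_true] ignores those: all of them end up on nodes of [tau]. *)
Definition multi_graft tau cs : {malg R[btree]} :=
  foldr (fun c => extend (graft_on_true c)) << mark true tau >> cs.

Lemma local_op_negb_mark phi (t : tree d) :
  local_op negb (mark_rule false phi) (mark false t) =
  extend (fun u => << mark false u >>) (local_op predT phi t).
Proof.
by rewrite -local_op_mark (local_op_split negb) [X in _ + X]local_op_mark0 ?addr0.
Qed.

(** The false nodes are those of the grafted trees, and the way in which these
    trees are attached does not depend on their content. *)
Lemma multi_graft_leibniz phi tau cs :
  extend (local_op negb (mark_rule false phi)) (multi_graft tau cs) =
  extend (multi_graft tau) (leibniz id (local_op_planted predT phi) cs).
Proof.
elim: cs => [|c cs IH].
  by rewrite /= extend0 extendU local_op_mark0.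
rewrite extend_leibniz_cons map_id.
have -> : extend (fun L => multi_graft tau (id c :: L))
    (leibniz id (local_op_planted predT phi) cs) =
  extend (fun z => extend (graft_on_true c)
           (local_op negb (mark_rule false phi) z)) (multi_graft tau cs).
  by rewrite -(extend_comp (graft_on_true c)) IH extend_comp.
have -> : multi_graft tau (c :: cs)
  = extend (graft_on_true c) (multi_graft tau cs) by [].
rewrite extend_comp.
transitivity (extend (fun z => extend (graft_on_true c)
    (local_op negb (mark_rule false phi) z)
  + local_op id (act_on_rule negb (mark_rule false phi)
                   (graft_rule R c.1 (mark false c.2))) z) (multi_graft tau cs)).
  apply: eq_extend => z; apply: local_op_commutator => [[] //|n p].
  case/extend_supp => q; rewrite mcoeffU => pq w.
  have <- : (q.1, map (mark_planted false) q.2) = p.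
    by apply/eqP; apply: contraNT pq => /negbTE ->; apply/eqP.
  by case/mapP => v _ ->; apply: local_op_mark0.
rewrite extend_funD addrC; apply: add_congr; last by [].
rewrite /local_op_planted /planting extend_comp.
transitivity (extend (fun z => extend (fun u =>
   graft_on_true (c.1, u) z) (local_op predT phi c.2)) (multi_graft tau cs)).
  apply: eq_extend => z; rewrite (eq_local_op _ _ (act_on_graft_rule _ _ _ _)).
  by rewrite local_op_extend local_op_negb_mark extend_comp;
    apply: eq_extend => u; rewrite extendU.
by rewrite extend_exchange; apply: eq_extend => u; rewrite extendU.
Qed.

(** The corrective term of the Guin-Oudom rule is the action on the trees which
    have already been grafted, i.e. on the false nodes: what remains is the
    grafting on the true ones. *)
Lemma guin_oudom_multi_graft tau b n cs : size cs = n ->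
  guin_oudom_rec R n (map (mark_planted false) cs) (b, mark true tau) =
  planting b (multi_graft tau cs).
Proof.
elim: n cs => [|n IH] [|c cs] //= => [_|[szcs]].
  by rewrite /planting extendU.
rewrite lextE IH //; under eq_bigr do rewrite lextE.
rewrite (leibniz_nth (fun s => guin_oudom_rec R n s (b, mark true tau))).
rewrite leibniz_map.
pose phi := graft_rule R c.1 c.2.
have mphi : mark_rule false phi =1 graft_rule R c.1 (mark false c.2).
  exact: mark_graft_rule.
have -> : leibniz (id \o mark_planted false)
    (pgraft R (mark_planted false c) \o mark_planted false) cs =
  extend (fun L => << map (mark_planted false) L >>)
    (leibniz id (local_op_planted predT phi) cs).
  rewrite -leibniz_extend_map; apply: eq_in_leibniz => w _; first by [].
  rewrite -local_op_planted_mark /= pgraftE /local_op_planted.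
  by rewrite (eq_local_op _ _ mphi).
rewrite extend_comp.
rewrite (@eq_size_leibniz _ _ _ _ _ (fun L => planting b (multi_graft tau L)));
  last by move=> L szL; rewrite extendU IH // szL.
rewrite -[X in _ - X]extend_comp -multi_graft_leibniz.
have -> : extend (pgraft R (mark_planted false c)) (planting b (multi_graft tau cs))
   = planting b (extend (local_op predT (graft_rule R c.1 (mark false c.2)))
                   (multi_graft tau cs)).
  rewrite -planting_comp; apply: eq_extend => w; exact: pgraftE.
rewrite -extendB; congr (extend _ _).
rewrite (eq_extend _ (fun z => eq_local_op _ z mphi)).
by rewrite (eq_extend _ (local_op_split id _)) extend_funD addrK.
Qed.

End MultiGraft.

(** * Raising the marked nodes *)

Section MultiIndexLemmas.
Variable d : nat.
Implicit Types (k l n : mi d) (i : 'I_d.+1).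

Lemma add_mie_diag k i : (k + mie i) i = (k i).+1.
Proof. by rewrite !ffunE eqxx; apply: addn1. Qed.

Lemma add_mie_off k i j : j != i -> (k + mie i) j = k j.
Proof. by move=> /negbTE ji; rewrite !ffunE ji; apply: addn0. Qed.

Lemma mi_ind (P : mi d -> Prop) :
  P 0 -> (forall n i, P n -> P (n + mie i)) -> forall n, P n.
Proof.
move=> P0 PS n; have [s ns] := ubnP (\sum_i n i)%N.
elim: s n ns => // s IH n ns.
have [/existsP [i ni]|] := boolP [exists i, 0 < n i]%N; last first.
  rewrite negb_exists => /forallP n0.
  suff -> : n = 0 by [].
  by apply/ffunP => i; have := n0 i; rewrite -eqn0Ngt ffunE => /eqP.
have nE : n = misub n (mie i) + mie i.
  apply/ffunP => j; rewrite !ffunE.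
  by have [->|_] := eqVneq j i; rewrite /= ?subn0 ?addr0 // [RHS]subnK.
rewrite nE; apply: PS; apply: IH.
rewrite {1}nE ltnS in ns; apply: leq_trans ns.
apply: (@leq_trans (\sum_j (misub n (mie i) j + mie i j))%N); last first.
  by apply: leq_sum => j _; rewrite [X in (_ <= X)%N]ffunE.
rewrite big_split /= -addn1 leq_add2l (bigD1 i) //=.
by rewrite ffunE eqxx.
Qed.

Lemma mifact_mie k i : mifact (k + mie i) = ((k i).+1 * mifact k)%N.
Proof.
rewrite /mifact (bigD1 i) //= [in RHS](bigD1 i) //= mulnA; congr (_ * _)%N.
  by rewrite add_mie_diag factS.
by apply: eq_bigr => j ji; rewrite add_mie_off.
Qed.

Lemma mifact_gt0 k : (0 < mifact k)%N.
Proof. by apply: prodn_gt0 => i; apply: fact_gt0. Qed.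

Lemma unbox_inj k : injective (@unbox d k).
Proof.
move=> l l' e; apply/ffunP => i; apply/val_inj.
by have := congr1 (fun f : mi d => f i) e; rewrite !ffunE.
Qed.

Lemma unbox_surj k l : mile l k -> exists b : box k, unbox b = l.
Proof.
move=> /forallP lk; exists [ffun i => inord (l i)]; apply/ffunP => i.
by rewrite !ffunE inordK // ltnS (leq_trans (lk i)) // (leq_bigmax i).
Qed.

End MultiIndexLemmas.

Section Raise.
Variables (d : nat) (M : Type).
Implicit Types (t : ptree d M) (k l : mi d) (v w : seq nat).

Fixpoint mapi (T U : Type) (F : nat -> T -> U) j (cs : seq T) : seq U :=
  if cs is c :: cs' then F j c :: mapi F j.+1 cs' else [::].

Lemma size_mapi (T U : Type) (F : nat -> T -> U) j cs :
  size (mapi F j cs) = size cs.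
Proof. by elim: cs j => //= c cs IH j; rewrite IH. Qed.

Lemma mapi_comp (T U W : Type) (F : nat -> T -> U) (G : nat -> U -> W) j cs :
  mapi G j (mapi F j cs) = mapi (fun p c => G p (F p c)) j cs.
Proof. by elim: cs j => //= c cs IH j; rewrite IH. Qed.

Lemma eq_mapi (T U : Type) (F G : nat -> T -> U) j cs :
  (forall p c, F p c = G p c) -> mapi F j cs = mapi G j cs.
Proof. by move=> FG; elim: cs j => //= c cs IH j; rewrite IH FG. Qed.

Lemma map_mapi (T U : Type) (F : nat -> T -> T) (f : T -> U) j cs :
  (forall p c, f (F p c) = f c) -> map f (mapi F j cs) = map f cs.
Proof. by move=> FG; elim: cs j => //= c cs IH j; rewrite IH FG. Qed.

Lemma onth_mapi (T : Type) (F : nat -> T -> T) j (cs : seq T) i :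
  onth (mapi F j cs) i = omap (F (j + i)%N) (onth cs i).
Proof.
elim: cs j i => [|c cs IH] j [|i] //=; first by rewrite addn0.
by rewrite IH addSnnS.
Qed.

Lemma modify_mapi f n x m (cs : seq (mi d * ptree d M)) i v :
  modify f (i :: v) (PNode n x m cs) =
  PNode n x m (mapi (fun p c => if p == i then (c.1, modify f v c.2) else c) 0 cs).
Proof.
rewrite [LHS]/=; congr PNode; move: (modify f v) => g.
by elim: cs 0%N => //= c cs IH j; rewrite IH.
Qed.

Lemma raise_comm k l v w t :
  raise k v (raise l w t) = raise l w (raise k v t).
Proof.
elim: v w t => [|i v IH] [|j w] [n x m cs].
- by rewrite /raise /=; congr PNode; rewrite addrAC.
- by [].
- by [].
rewrite /raise !modify_mapi !mapi_comp; congr PNode; apply: eq_mapi => p c.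
have IHc := IH w c.2; rewrite /raise in IHc.
by do 2 case: eqP => //= _; rewrite IHc.
Qed.

Lemma raise_add k l v t : raise k v (raise l v t) = raise (l + k) v t.
Proof.
rewrite /raise modify_modify; apply: eq_modify.
by case: (subtree v t) => n x m cs; rewrite addrA.
Qed.

Lemma raise0 v t : raise 0 v t = t.
Proof.
elim: v t => [|i v IH] [n x m cs]; first by rewrite /raise /= addr0.
rewrite /raise modify_mapi; congr PNode.
elim: cs 0%N => [|[a c] cs IHcs] j //=; rewrite IHcs; congr (_ :: _).
by case: eqP => //= _; have := IH c; rewrite /raise => ->.
Qed.

Lemma nodes_raise k v t : nodes (raise k v t) = nodes t.
Proof.
elim: v t => [|i v IH] [n x m cs]; first by [].
rewrite /raise modify_mapi /= size_mapi map_mapi // => p c.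
by case: eqP => //= _; have := IH c.2; rewrite /raise => ->.
Qed.

Lemma pmark_subtree_raise k v w t :
  pmark (subtree w (raise k v t)) = pmark (subtree w t).
Proof.
elim: v w t => [|i v IH] [|j w] [n x m cs]; try by [].
  by rewrite /=; case: (onth cs j).
rewrite /raise modify_mapi /= onth_mapi; case: (onth cs j) => //= c.
by case: eqP => //= _; have := IH w c.2; rewrite /raise => ->.
Qed.

Definition raise_seq (vs : seq (seq nat)) (K : 'I_(size vs) -> mi d) t
    (e : seq 'I_(size vs)) : ptree d M :=
  foldr (fun j u => raise (K j) (nth [::] vs j) u) t e.

Lemma raise_seq_step vs (K : 'I_(size vs) -> mi d) t e j k : uniq e ->
  raise_seq (fun j' => K j' + (if j' == j then k else 0)) t e =
  if j \in e then raise k (nth [::] vs j) (raise_seq K t e)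
  else raise_seq K t e.
Proof.
elim: e => //= j' e IH /andP[j'e ue]; rewrite inE IH // [j' == j]eq_sym.
case: eqVneq j'e => [<-|_] j'e /=; first by rewrite (negbTE j'e) raise_add.
by rewrite addr0; case: ifP => // _; apply: raise_comm.
Qed.

Lemma raise_seq0 vs t e : @raise_seq vs (fun=> 0) t e = t.
Proof. by elim: e => //= j e ->; apply: raise0. Qed.

Lemma nodes_raise_seq vs (K : 'I_(size vs) -> mi d) t e :
  nodes (raise_seq K t e) = nodes t.
Proof. by elim: e => //= j e <-; apply: nodes_raise. Qed.

Lemma pmark_raise_seq vs (K : 'I_(size vs) -> mi d) t e v :
  pmark (subtree v (raise_seq K t e)) = pmark (subtree v t).
Proof. by elim: e => //= j e <-; apply: pmark_subtree_raise. Qed.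

End Raise.

Lemma mcoeff_extend_inj (R : fieldType) (X : choiceType) (h : X -> X)
    (u : {malg R[X]}) (K : X) : injective h ->
  (extend (fun K => << h K >>) u)@_(h K) = u@_K.
Proof.
move=> hi; rewrite mcoeff_extend.
have [Ku|Ku] := boolP (K \in msupp u); last first.
  rewrite (mcoeff_outdom Ku) big_seq big1 // => K' K'u; rewrite mcoeffU.
  by case: eqP => [/hi KK|_]; [rewrite -KK K'u in Ku | rewrite mulr0].
rewrite (big_fsetD1 K) //= mcoeffU eqxx mulr1 big1_fset ?addr0 // => K'.
rewrite in_fsetD1 => /andP[KK _] _; rewrite mcoeffU.
by case: eqP => [/hi e|_]; [rewrite e eqxx in KK | rewrite mulr0].
Qed.

Section Multinomial.
Variables (R : realType) (d s : nat).
Local Notation family := {ffun 'I_s -> mi d}.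
Implicit Types (k : mi d) (K : family) (i : 'I_d.+1) (j : 'I_s).

Definition multinomial k K : R :=
  if \sum_j K j == k then (mifact k)%:R / (\prod_j mifact (K j))%:R else 0.

(** The weights of [raise_marked], collected in a free module so that
    identities between them can be checked coefficient by coefficient. *)
Definition multinomial_sum k : {malg R[family]} :=
  \sum_(K : {ffun 'I_s -> box k} | \sum_j unbox (K j) == k)
    ((mifact k)%:R / (\prod_j mifact (unbox (K j)))%:R) *:
      << [ffun j => unbox (K j)] >>.

Definition single j i : family := [ffun j' => if j' == j then mie i else 0].

Lemma mcoeff_multinomial_sum k K : (multinomial_sum k)@_K = multinomial k K.
Proof.
rewrite /multinomial_sum raddf_sum /multinomial /=.
have [Kk|Kk] := eqVneq (\sum_j K j) k; last first.
  apply: big1 => B /eqP Bk; rewrite mcoeffZ mcoeffU.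
  case: eqP => [BK|_]; last by rewrite mulr0n mulr0.
  case/eqP: Kk; rewrite -BK -[RHS]Bk; apply: eq_bigr => j _; by rewrite ffunE.
have Kj j : mile (K j) k.
  apply/forallP => i; rewrite -Kk (bigD1 j) //= ffunE.
  exact: leq_addr.
have [B BE] : exists B : {ffun 'I_s -> box k}, forall j, unbox (B j) = K j.
  have h j : exists b : box k, unbox b == K j.
    by have [b <-] := unbox_surj (Kj j); exists b.
  exists [ffun j => xchoose (h j)] => j; rewrite ffunE.
  exact/eqP/(xchooseP (h j)).
rewrite (bigD1 B) /=; last by under eq_bigr do rewrite BE; apply/eqP.
rewrite [X in _ + X]big1 ?addr0; last first.
  move=> B' /andP[_ /eqP nB]; rewrite mcoeffZ mcoeffU.
  case: eqP => [BK|_]; last by rewrite mulr0n mulr0.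
  case: nB; apply/ffunP => j; apply: (@unbox_inj _ k).
  by rewrite BE -BK ffunE.
rewrite mcoeffZ mcoeffU.
have -> : [ffun j => unbox (B j)] = K by apply/ffunP => j; rewrite ffunE.
by rewrite eqxx mulr1; congr (_ / _%:R); apply: eq_bigr => j _; rewrite BE.
Qed.

Lemma multinomial_sum0 : multinomial_sum 0 = << 0 >>.
Proof.
apply/malgP => K; rewrite mcoeff_multinomial_sum mcoeffU /multinomial.
have -> : (\sum_j K j == 0) = (0 == K).
  apply/eqP/eqP => [K0|<-]; last by rewrite big1 // => j _; rewrite ffunE.
  apply/ffunP => j; apply/ffunP => i; rewrite !ffunE; apply/esym/eqP.
  have := congr1 (fun f : mi d => f i) K0.
  rewrite (bigD1 j) //= !ffunE => /eqP; by rewrite addn_eq0 => /andP[].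
case: eqP => [<-|//].
rewrite big1 => [|j _]; last by rewrite ffunE /mifact big1 // => i _; rewrite ffunE.
by rewrite /mifact big1 ?divr1 // => i _; rewrite ffunE.
Qed.

Lemma sum_single j i K : \sum_j' (K + single j i) j' = \sum_j' K j' + mie i.
Proof.
transitivity (\sum_j' (K j' + if j' == j then mie i else 0)).
  by apply: eq_bigr => j' _; rewrite !ffunE.
by rewrite big_split -big_mkcond big_pred1_eq.
Qed.

Lemma add_single_diag j i K : (K + single j i) j = K j + mie i.
Proof. by rewrite ffunE [single _ _ _]ffunE eqxx. Qed.

Lemma prod_mifact_single j i K :
  (\prod_j' mifact ((K + single j i)%R j') =
   (K j i).+1 * \prod_j' mifact (K j'))%N.
Proof.
rewrite (bigD1 j) //= [in RHS](bigD1 j) //= mulnA; congr (_ * _)%N.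
  by rewrite add_single_diag mifact_mie.
by apply: eq_bigr => j' j'j; rewrite !ffunE (negbTE j'j) addr0.
Qed.

Lemma mi_addrI : right_injective (+%R : mi d -> mi d -> mi d).
Proof.
move=> a b c e; apply/ffunP => i.
have := congr1 (fun f : mi d => f i) e; rewrite !ffunE; exact: addnI.
Qed.

(** Pascal's rule for multinomial coefficients: incrementing [k] amounts to
    incrementing one member of the family, in all possible ways. *)
Lemma multinomial_sum_mie k i :
  multinomial_sum (k + mie i) =
  \sum_j extend (fun K => << K + single j i >>) (multinomial_sum k).
Proof.
apply/malgP => K; rewrite mcoeff_multinomial_sum raddf_sum /=.
have shift_inj j : injective (fun K : family => K + single j i).
  move=> K1 K2 e; apply/ffunP => j'.
  have := congr1 (fun f : family => f j') e; rewrite /= [LHS]ffunE [RHS]ffunE.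
  by rewrite ![_ + single j i j']addrC => /mi_addrI.
have coeff j : (extend (fun K => << K + single j i >>) (multinomial_sum k))@_K =
    if \sum_j K j == k + mie i
    then (mifact k)%:R * (K j i)%:R / (\prod_j mifact (K j))%:R else 0.
  have [Kji|Kji] := posnP (K j i).
    rewrite Kji mulr0 mul0r if_same mcoeff_extend big1 // => K' _.
    rewrite mcoeffU; case: eqP => [e|_]; last by rewrite mulr0.
    by move: Kji; rewrite -e add_single_diag add_mie_diag.
  pose K' : family := [ffun j' => if j' == j then misub (K j') (mie i) else K j'].
  have KE : K = K' + single j i.
    apply/ffunP => j'; rewrite !ffunE; have [->|_] := eqVneq j' j; last first.
      by rewrite addr0.
    apply/ffunP => i'; rewrite !ffunE; have [->|_] := eqVneq i' i.
      by rewrite [RHS]subnK.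
    by rewrite /= subn0 addr0.
  rewrite {1}KE (mcoeff_extend_inj _ _ (@shift_inj j)) mcoeff_multinomial_sum.
  rewrite KE sum_single prod_mifact_single /multinomial.
  have -> : (\sum_j' K' j' + mie i == k + mie i) = (\sum_j' K' j' == k).
    apply/eqP/eqP => [|-> //]; rewrite ![_ + mie i]addrC; exact: mi_addrI.
  case: ifP => // _.
  have -> : (K' + single j i) j i = (K' j i).+1.
    by rewrite add_single_diag add_mie_diag.
  have nz : (\prod_j' mifact (K' j'))%:R != 0 :> R.
    by rewrite pnatr_eq0 -lt0n prodn_gt0 // => j'; apply: mifact_gt0.
  rewrite natrM invfM mulrA mulfK //.
  by rewrite pnatr_eq0.
under eq_bigr do rewrite coeff.
rewrite /multinomial; case: eqP => [Kk|_]; last by rewrite big1.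
rewrite -mulr_suml -mulr_sumr -natr_sum mifact_mie mulnC natrM.
congr (_ * _%:R / _).
have := congr1 (fun f : mi d => f i) Kk.
by rewrite add_mie_diag sum_ffunE => <-.
Qed.

End Multinomial.

(** The operator of [raise_marked] before the marks are erased, which is the one
    that can be iterated. *)
HB.lock Definition raise_true (R : realType) (d : nat) (k : mi d)
    (t : dtree d bool) : {malg R[dtree d bool]} :=
  let vs := [seq v <- nodes (repr t) | pmark (subtree v (repr t))] in
  extend (fun K : {ffun 'I_(size vs) -> mi d} =>
            << \pi_(dtree d bool) (raise_seq K (repr t) (enum 'I_(size vs))) >>)
         (multinomial_sum R (size vs) k).

Section RaiseMarked.
Variables (R : realType) (d : nat).
Local Notation btree := (dtree d bool).
Local Notation raise_true := (@raise_true R d).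

Lemma raise_markedE k (t : btree) :
  raise_marked R k t = extend (fun u => << mark tt u >>) (raise_true k t).
Proof.
rewrite raise_true.unlock /raise_marked /multinomial_sum !extend_sum.
apply: eq_bigr => K _; rewrite !extendZ !extendU mark_pi; congr (_ *: << _ >>).
congr (\pi_(tree d) (relabel _ _)); rewrite /raise_seq.
elim: (enum _) => //= j e ->; by rewrite ffunE.
Qed.

Lemma raise_true0 (t : btree) : raise_true 0 t = << t >>.
Proof.
rewrite raise_true.unlock; cbv zeta; rewrite multinomial_sum0 extendU; congr << _ >>.
set vs := [seq _ <- _ | _].
rewrite -[RHS]reprK; congr (\pi_btree _).
rewrite -[RHS](@raise_seq0 _ _ vs (repr t) (enum 'I_(size vs))) /raise_seq.
elim: (enum _) => //= j e ->; by rewrite ffunE.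
Qed.

(** Raising one more time: the increment e_i may be given to any true node. *)
Lemma raise_true_mie k i (t : btree) :
  raise_true (k + mie i) t =
  extend (local_op id (@raise_rule R d bool i)) (raise_true k t).
Proof.
rewrite raise_true.unlock; cbv zeta; rewrite multinomial_sum_mie extend_sum extend_comp.
set vs := [seq _ <- _ | _].
under eq_bigr do rewrite extend_comp.
rewrite -extend_fun_sum; apply: eq_extend => K; rewrite extendU local_op_pi.
rewrite /planar_local nodes_raise_seq.
under [RHS]eq_bigl do rewrite pmark_raise_seq.
rewrite -big_filter -/vs (big_nth [::]) big_mkord; apply: eq_bigr => j _.
rewrite !extendU; congr << _ >>; congr (\pi_btree _).
transitivity (raise_seq (fun j' => K j' + (if j' == j then mie i else 0))
    (repr t) (enum 'I_(size vs))).
  rewrite /raise_seq; elim: (enum _) => //= j' e ->; by rewrite !ffunE.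
rewrite raise_seq_step ?enum_uniq // mem_enum inE.
by apply: eq_modify; case: (subtree _ _).
Qed.

End RaiseMarked.

(** * The product of the enveloping algebra of a post-Lie algebra *)

Section EnvelopeInduction.
Variables (R : fieldType) (V : lmodType R) (br : V -> V -> V).
Local Notation U := (uea br).

(** The enveloping algebra is generated by the Lie algebra. *)
Lemma uea_ind (P : U -> Prop) :
  P 1 -> (forall x, P (uinj br x)) -> (forall A B, P A -> P B -> P (A + B)) ->
  (forall A B, P A -> P B -> P (A * B)) -> (forall c A, P A -> P (c *: A)) ->
  forall A, P A.
Proof.
move=> P1 Pv PD PM PZ A; rewrite -(reprK A).
elim: (repr A) => [||x|s Ps t Pt|s Ps t Pt|c s Ps].
- by have := PZ 0 1 P1; rewrite scale0r.
- exact: P1.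
- exact: Pv.
- suff -> : \pi_U (Uadd s t) = \pi_U s + \pi_U t by apply: PD.
  by apply: ueaP => B f lf; rewrite (uliftE lf) !ulift_pi.
- suff -> : \pi_U (Umul s t) = \pi_U s * \pi_U t by apply: PM.
  by apply: ueaP => B f lf; rewrite (uliftE lf) !ulift_pi.
suff -> : \pi_U (Uscale c s) = c *: \pi_U s by apply: PZ.
by apply: ueaP => B f lf; rewrite (uliftE lf) !ulift_pi.
Qed.

Definition monomial (s : seq V) : U := \prod_(x <- s) uinj br x.

(** The enveloping algebra is spanned by the products of elements of the Lie
    algebra. *)
Lemma monomial_ind (P : U -> Prop) :
  (forall s, P (monomial s)) -> (forall A B, P A -> P B -> P (A + B)) ->
  (forall c A, P A -> P (c *: A)) -> forall A, P A.
Proof.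
move=> Pm PD PZ A.
suff [r ->] : exists r : seq (R * seq V), A = \sum_(p <- r) p.1 *: monomial p.2.
  elim: r => [|p r IH]; last by rewrite big_cons; apply: PD => //; apply: PZ.
  by rewrite big_nil -(scale0r (monomial [::])); apply: PZ.
elim/uea_ind: A => [|x|A B [r ->] [r' ->]|A B [r ->] [r' ->]|c A [r ->]].
- by exists [:: (1, [::])]; rewrite big_seq1 scale1r /monomial big_nil.
- by exists [:: (1, [:: x])]; rewrite big_seq1 scale1r /monomial big_seq1.
- by exists (r ++ r'); rewrite big_cat.
- exists [seq (p.1 * q.1, p.2 ++ q.2) | p <- r, q <- r'].
  rewrite big_allpairs_dep /= big_distrl; apply: eq_bigr => p _ /=.
  rewrite big_distrr; apply: eq_bigr => q _ /=.
  by rewrite /monomial big_cat -scalerAl -scalerAr scalerA.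
exists [seq (c * p.1, p.2) | p <- r]; rewrite big_map scaler_sumr.
by apply: eq_bigr => p _; rewrite scalerA.
Qed.

End EnvelopeInduction.

Section LinearFacts.
Variables (R : fieldType) (V W : lmodType R) (f : V -> W).
Hypothesis lf : linear f.

Lemma linear_raw0 : f 0 = 0.
Proof. by have := lf (-1) 0 0; rewrite !scaleN1r !addNr. Qed.

Lemma linear_rawD x y : f (x + y) = f x + f y.
Proof. by have := lf 1 x y; rewrite !scale1r. Qed.

Lemma linear_rawZ c x : f (c *: x) = c *: f x.
Proof. by have := lf c x 0; rewrite linear_raw0 !addr0. Qed.

End LinearFacts.

Section Contraction.
Variables (R : fieldType) (A : algType R).

Lemma contract_linear (W : lmodType R) (f : A -> A -> W) :
  bilinear_map f -> linear (contract f).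
Proof.
move=> bf c s t; transitivity (contract f (tscale c s) + contract f t).
  exact: (contractE bf).1.2.1.
by rewrite (contractE bf).
Qed.

Lemma contract_tpure (W : lmodType R) (f : A -> A -> W) x y :
  bilinear_map f -> contract f (tpure x y) = f x y.
Proof. by move=> bf; rewrite (contractE bf). Qed.

Lemma contractM (W : lmodType R) (f : A -> A -> W) (s t : tens A) :
  bilinear_map f ->
  contract f (s * t) =
  contract (fun a b => contract (fun c e => f (a * c) (b * e)) t) s.
Proof. by move=> bf; apply: (contractE bf).2. Qed.

Lemma contractB (W : lmodType R) (f g : A -> A -> W) (t : tens A) :
  contract (fun x y => f x y - g x y) t = contract f t - contract g t.
Proof. by rewrite /contract /tsum sumrB. Qed.

Lemma linear_contract (W W' : lmodType R) (h : W -> W') (f : A -> A -> W)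
    (t : tens A) : linear h ->
  h (contract f t) = contract (fun a b => h (f a b)) t.
Proof.
move=> lh; rewrite /contract /tsum; elim: (repr t) => [|p s IH].
  by rewrite !big_nil (linear_raw0 lh).
by rewrite !big_cons (linear_rawD lh) IH.
Qed.

Lemma bilinear_mapD (W : lmodType R) (f g : A -> A -> W) :
  bilinear_map f -> bilinear_map g -> bilinear_map (fun a b => f a b + g a b).
Proof.
move=> [fl fr] [gl gr]; split=> [y c x x'|x c y y'] /=.
  by rewrite (fl y) (gl y) scalerDr addrACA.
by rewrite (fr x) (gr x) scalerDr addrACA.
Qed.

Lemma bilinear_map_comp (W : lmodType R) (f : A -> A -> W) (h k : A -> A) :
  bilinear_map f -> linear h -> linear k ->
  bilinear_map (fun a b => f (h a) (k b)).
Proof.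
move=> [fl fr] lh lk; split=> [y c x x'|x c y y'] /=.
  by rewrite lh fl.
by rewrite lk fr.
Qed.

Lemma bilinear_mul_map (h k : A -> A) :
  linear h -> linear k -> bilinear_map (fun a b => h a * k b).
Proof.
move=> lh lk; split=> [y c x x'|x c y y'] /=.
  by rewrite lh mulrDl scalerAl.
by rewrite lk mulrDr scalerAr.
Qed.

Lemma linear_id : linear (fun a : A => a). Proof. by []. Qed.

Lemma linear_mull (b : A) : linear (fun a : A => b * a).
Proof. by move=> c x y; rewrite mulrDr scalerAr. Qed.

Lemma linear_comp_raw (V V' W : lmodType R) (f : V' -> W) (g : V -> V') :
  linear f -> linear g -> linear (fun x => f (g x)).
Proof. by move=> lf lg c x y; rewrite lg lf. Qed.

End Contraction.

Section PostLieExtension.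
Variables (R : fieldType) (V : lmodType R) (br tri : V -> V -> V).
Local Notation U := (uea br).
Local Notation "'v x" := (uinj br x) (at level 10, x at level 8).
Variable T : U -> U -> U.
Hypothesis extT : extends_product tri T.

Let Tl B : linear (T^~ B). Proof. exact: (ext_bilinear extT).1. Qed.
Let Tr A : linear (T A). Proof. exact: (ext_bilinear extT).2. Qed.

Lemma coproduct_linear : linear (@coproduct R V br).
Proof. by move=> c x y; rewrite coproductP. Qed.

Lemma contract_primitive (W : lmodType R) (f : U -> U -> W) x :
  bilinear_map f -> contract f (primitive br x) = f ('v x) 1 + f 1 ('v x).
Proof.
move=> bf; rewrite /primitive (linear_rawD (contract_linear bf)).
by rewrite !contract_tpure.
Qed.

Lemma contract_coproduct1 (W : lmodType R) (f : U -> U -> W) :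
  bilinear_map f -> contract f (coproduct 1) = f 1 1.
Proof. by move=> bf; rewrite coproduct1 [1]/(tpure 1 1) contract_tpure. Qed.

Lemma contract_coproduct_mulV (W : lmodType R) (f : U -> U -> W) x A :
  bilinear_map f ->
  contract f (coproduct ('v x * A)) =
  contract (fun a b => f ('v x * a) b + f a ('v x * b)) (coproduct A).
Proof.
move=> bf; rewrite coproductM contractM // coproduct_uinj contract_primitive.
  rewrite contractD; congr (_ + _); apply: eq_contract => a b.
    by rewrite mul1r.
  by rewrite mul1r.
exact: bilinear_contract.
Qed.

(** Elements of the Lie algebra are primitive. *)
Lemma post_lie_derivation x B C :
  T ('v x) (B * C) = T ('v x) B * C + B * T ('v x) C.
Proof.
rewrite (ext_mul extT) coproduct_uinj contract_primitive.
  by rewrite !(ext_1 extT).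
exact: bilinear_mul_map.
Qed.

(** The action of an element of the Lie algebra is also a coderivation, because
    it preserves the space of primitive elements. It is stated after applying
    an arbitrary bilinear map to the tensors. *)
Lemma contract_coproduct_derivation (W : lmodType R) (f : U -> U -> W) x A :
  bilinear_map f ->
  contract f (coproduct (T ('v x) A)) =
  contract (fun a b => f (T ('v x) a) b + f a (T ('v x) b)) (coproduct A).
Proof.
have bT (W' : lmodType R) (g : U -> U -> W') : bilinear_map g ->
    bilinear_map (fun a b => g (T ('v x) a) b + g a (T ('v x) b)).
  move=> bg; apply: bilinear_mapD.
    exact: (bilinear_map_comp bg (Tr _) (@linear_id _ _)).
  exact: (bilinear_map_comp bg (@linear_id _ _) (Tr _)).
have lin (W' : lmodType R) (g : U -> U -> W') : bilinear_map g ->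
    linear (fun B => contract g (coproduct B)).
  move=> bg; apply: linear_comp_raw (contract_linear bg) coproduct_linear.
elim/uea_ind: A W f => [|y|A B IHA IHB|A B IHA IHB|c A IHA] W f bf.
- have [fl fr] := bf.
  rewrite (ext_V1 extT) (linear_raw0 (lin _ _ bf)) (contract_coproduct1 (bT _ _ bf)).
  rewrite (ext_V1 extT) (linear_raw0 (fl _)) (linear_raw0 (fr _)).
  by rewrite addr0.
- have [fl fr] := bf.
  rewrite (ext_V extT) !coproduct_uinj (contract_primitive _ bf) (contract_primitive _ (bT _ _ bf)).
  rewrite (ext_V1 extT) (ext_V extT).
  by rewrite (linear_raw0 (fl _)) (linear_raw0 (fr _)) addr0 add0r.
- rewrite (linear_rawD (Tr _)) (linear_rawD (lin _ _ bf)) IHA // IHB //.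
  by rewrite (linear_rawD (lin _ _ (bT _ _ bf))).
- rewrite post_lie_derivation (linear_rawD (lin _ _ bf)) !coproductM !(contractM _ _ bf).
  rewrite (contractM _ _ (bT _ _ bf)).
  rewrite IHA; last exact: bilinear_contract.
  rewrite -contractD; apply: eq_contract => a b.
  rewrite IHB; last exact: bilinear_mul.
  rewrite -!contractD; apply: eq_contract => c e.
  have [fl fr] := bf.
  rewrite !post_lie_derivation (linear_rawD (fl _)) (linear_rawD (fr _)).
  by rewrite addrACA.
rewrite (linear_rawZ (Tr _)) (linear_rawZ (lin _ _ bf)) IHA //.
by rewrite (linear_rawZ (lin _ _ (bT _ _ bf))).
Qed.

Lemma monomial_cons x s : monomial br (x :: s) = 'v x * monomial br s.
Proof. by rewrite /monomial big_cons. Qed.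

Lemma monomial_nil : monomial br [::] = 1.
Proof. by rewrite /monomial big_nil. Qed.

Let mulV_l (W : lmodType R) (f : U -> U -> W) x : bilinear_map f ->
  bilinear_map (fun a b => f ('v x * a) b).
Proof.
move=> bf; exact: (bilinear_map_comp bf (linear_mull _) (@linear_id _ _)).
Qed.

Let mulV_r (W : lmodType R) (f : U -> U -> W) x : bilinear_map f ->
  bilinear_map (fun a b => f a ('v x * b)).
Proof.
move=> bf; exact: (bilinear_map_comp bf (@linear_id _ _) (linear_mull _)).
Qed.

(** In the coproduct of a monomial, the two factors are monomials whose lengths
    add up to its length. The next three lemmas discard the terms on which a
    bilinear map vanishes for reasons of length. *)
Lemma contract_monomial0 (W : lmodType R) (f : U -> U -> W) s :
  bilinear_map f ->
  (forall p q, (size p + size q)%N = size s ->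
     f (monomial br p) (monomial br q) = 0) ->
  contract f (coproduct (monomial br s)) = 0.
Proof.
elim: s f => [|x s IH] f bf f0.
  by rewrite monomial_nil contract_coproduct1 // -monomial_nil f0.
rewrite monomial_cons contract_coproduct_mulV // contractD.
rewrite (IH _ (mulV_l x bf)) ?(IH _ (mulV_r x bf)) ?addr0 // => p q pq.
  by rewrite -monomial_cons f0 //= addnS pq.
by rewrite -monomial_cons f0 //= addSn pq.
Qed.

Lemma contract_monomial_l (W : lmodType R) (f : U -> U -> W) s :
  bilinear_map f ->
  (forall p y q, (size p + size q).+1 = size s ->
     f (monomial br p) (monomial br (y :: q)) = 0) ->
  contract f (coproduct (monomial br s)) = f (monomial br s) 1.
Proof.
elim: s f => [|x s IH] f bf f0.
  by rewrite monomial_nil contract_coproduct1.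
rewrite monomial_cons contract_coproduct_mulV // contractD.
rewrite (IH _ (mulV_l x bf)); last first.
  by move=> p y q pq; rewrite -monomial_cons f0 //= addSn pq.
rewrite contract_monomial0 ?addr0 //; first exact: mulV_r.
by move=> p q pq; rewrite -monomial_cons f0 // pq.
Qed.

Lemma contract_monomial_r (W : lmodType R) (f : U -> U -> W) s :
  bilinear_map f ->
  (forall y p q, (size p + size q).+1 = size s ->
     f (monomial br (y :: p)) (monomial br q) = 0) ->
  contract f (coproduct (monomial br s)) = f 1 (monomial br s).
Proof.
elim: s f => [|x s IH] f bf f0.
  by rewrite monomial_nil contract_coproduct1.
rewrite monomial_cons contract_coproduct_mulV // contractD addrC.
rewrite (IH _ (mulV_r x bf)); last first.
  by move=> y p q pq; rewrite -monomial_cons f0 //= addnS pq.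
rewrite contract_monomial0 ?addr0 //; first exact: mulV_l.
by move=> p q pq; rewrite -monomial_cons f0 // pq.
Qed.

(** [A |-> T A 1] is idempotent for the convolution product, hence vanishes on
    monomials of positive length, by induction on the length: in the
    coproduct of such a monomial, the terms with two nontrivial factors
    contribute nothing and the other two give twice the same value. *)
Lemma ext_monomial1 x s : T (monomial br (x :: s)) 1 = 0.
Proof.
have [n ns] := ubnP (size s); elim: n s x ns => // n IH s x ns.
pose f a b := T a 1 * T b 1.
have bf : bilinear_map f by apply: bilinear_mul_map.
have f0 y p z q : (size p + size q).+1 = size s ->
    f (monomial br (y :: p)) (monomial br (z :: q)) = 0.
  move=> pq; rewrite /f IH ?mul0r //; rewrite ltnS in ns.
  by apply: leq_trans ns; rewrite -pq ltnS leq_addr.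
have T11 : T 1 1 = 1 := ext_1 extT 1.
have : T (monomial br (x :: s)) 1 =
    T (monomial br (x :: s)) 1 + T (monomial br (x :: s)) 1.
  rewrite -{1}[1](mulr1 1) (ext_mul extT) -/f {1}monomial_cons.
  rewrite contract_coproduct_mulV // contractD.
  rewrite contract_monomial_l; first last.
  - by move=> p y q pq; rewrite -monomial_cons f0.
  - exact: mulV_l.
  rewrite contract_monomial_r; first last.
  - by move=> y p q pq; rewrite -monomial_cons f0.
  - exact: mulV_r.
  by rewrite /f T11 mulr1 mul1r -monomial_cons.
by move/eqP; rewrite -[X in X == _]addr0 => /eqP /addrI <-.
Qed.

Lemma ext_mul1 x A : T ('v x * A) 1 = 0.
Proof.
elim/monomial_ind: A => [s|A B IHA IHB|c A IHA].
- by rewrite -monomial_cons ext_monomial1.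
- by rewrite mulrDr (linear_rawD (Tl 1)) IHA IHB addr0.
by rewrite -scalerAr (linear_rawZ (Tl 1)) IHA scaler0.
Qed.

Lemma ext_V_ext1 x A : T ('v x) (T A 1) = 0.
Proof.
elim/monomial_ind: A => [[|y s]|A B IHA IHB|c A IHA].
- by rewrite monomial_nil (ext_1 extT) (ext_V1 extT).
- by rewrite ext_monomial1 (linear_raw0 (Tr _)).
- by rewrite (linear_rawD (Tl 1)) (linear_rawD (Tr _)) IHA IHB addr0.
by rewrite (linear_rawZ (Tl 1)) (linear_rawZ (Tr _)) IHA scaler0.
Qed.

Lemma ext_ext_V1 x A : T (T ('v x) A) 1 = 0.
Proof.
elim/monomial_ind: A => [s|A B IHA IHB|c A IHA].
- elim: s => [|y s IH].
    by rewrite monomial_nil (ext_V1 extT) (linear_raw0 (Tl _)).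
  rewrite monomial_cons post_lie_derivation (linear_rawD (Tl _)).
  by rewrite (ext_V extT) !ext_mul1 addr0.
- by rewrite (linear_rawD (Tr _)) (linear_rawD (Tl _)) IHA IHB addr0.
by rewrite (linear_rawZ (Tr _)) (linear_rawZ (Tl _)) IHA scaler0.
Qed.

(** The axiom on generators propagates to products: the three terms are
    compatible with the splitting of their first argument by the coproduct. *)
Lemma ext_mulV_all x A B :
  T ('v x * A) B = T ('v x) (T A B) - T (T ('v x) A) B.
Proof.
elim/uea_ind: B A => [|y|B C IHB IHC|B C IHB IHC|c B IHB] A.
- by rewrite ext_mul1 ext_V_ext1 ext_ext_V1 subr0.
- exact: ext_mulV extT _ _ _.
- by rewrite !(linear_rawD (Tr _)) IHB IHC opprD addrACA.
- have bm D E : bilinear_map (fun a b => T a D * T b E).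
    exact: bilinear_mul_map.
  rewrite !(ext_mul extT) contract_coproduct_mulV //.
  rewrite contract_coproduct_derivation // (linear_contract _ _ (Tr _)) -contractB.
  apply: eq_contract => a b; rewrite IHB IHC post_lie_derivation.
  by rewrite mulrBl mulrBr opprD addrACA.
by rewrite !(linear_rawZ (Tr _)) IHB scalerBr.
Qed.

Lemma star_bilinear B : bilinear_map (fun a b => a * T b B).
Proof. exact: (bilinear_mul_map (@linear_id _ _)). Qed.

Lemma star_linear B : linear (fun A => star T A B).
Proof.
apply: linear_comp_raw coproduct_linear; apply: contract_linear.
exact: star_bilinear.
Qed.

Lemma star1 B : star T 1 B = B.
Proof.
rewrite /star contract_coproduct1; last exact: star_bilinear.
by rewrite (ext_1 extT) mul1r.
Qed.

(** The recursion of Guin and Oudom for the product, [x * C = x C + x |> C]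
    being the product with an element of the post-Lie algebra. *)
Lemma star_mulV x A B :
  star T ('v x * A) B =
  'v x * star T A B + T ('v x) (star T A B) - star T (T ('v x) A) B.
Proof.
have bf := star_bilinear B.
rewrite /star contract_coproduct_mulV // contract_coproduct_derivation //.
rewrite (linear_contract _ _ (linear_mull _)) (linear_contract _ _ (Tr _)).
rewrite -contractD -contractB; apply: eq_contract => a b.
rewrite ext_mulV_all post_lie_derivation mulrA mulrBr.
by rewrite opprD !addrA; congr (_ - _); rewrite addrAC addrK.
Qed.

End PostLieExtension.

(** * Ordered monomials in the X_i and the planted trees *)

Section BinomialSum.
Variables (R : realType) (d : nat).
Implicit Types (n l a : mi d) (i : 'I_d.+1).

(** The binomial weights of the deformed grafting, in a free module. *)
Definition binomial_sum n : {malg R[mi d]} :=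
  \sum_(l : box n) (mibin n (unbox l))%:R *: << unbox l >>.

Lemma mibin_small n l : ~~ mile l n -> mibin n l = 0%N.
Proof.
rewrite negb_forall => /existsP[i]; rewrite -ltnNge => ln.
by rewrite /mibin (bigD1 i) //= bin_small.
Qed.

Lemma mcoeff_binomial_sum n l : (binomial_sum n)@_l = (mibin n l)%:R.
Proof.
rewrite /binomial_sum raddf_sum /=.
have [ln|ln] := boolP (mile l n); last first.
  rewrite mibin_small // big1 // => b _; rewrite mcoeffZ mcoeffU.
  by case: eqP => [e|_]; rewrite ?mulr0n ?mulr0 // e mibin_small // mul0r.
have [b bl] := unbox_surj ln.
rewrite (bigD1 b isT) /= [X in X + _]mcoeffZ mcoeffU bl eqxx mulr1.
rewrite big1 ?addr0 // => b' /eqP b'b; rewrite mcoeffZ mcoeffU.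
case: eqP => [e|_]; last by rewrite mulr0n mulr0.
by case: b'b; apply: unbox_inj; rewrite e bl.
Qed.

Lemma binomial_sum0 : binomial_sum 0 = << 0 >>.
Proof.
apply/malgP => l; rewrite mcoeff_binomial_sum mcoeffU.
case: eqP => [<-|l0].
  by rewrite /mibin big1 // => i _; rewrite ffunE bin0.
rewrite mibin_small //; apply/negP => /forallP l00; apply: l0.
by apply/ffunP => i; have := l00 i; rewrite !ffunE leqn0 => /eqP ->.
Qed.

Lemma mibin_mie_off n l i : l i = 0%N -> mibin (n + mie i) l = mibin n l.
Proof.
move=> li; apply: eq_bigr => j _; have [->|ji] := eqVneq j i.
  by rewrite li !bin0.
by rewrite add_mie_off.
Qed.

Lemma mibin_mie n l i :
  mibin (n + mie i) (l + mie i) = (mibin n (l + mie i)%R + mibin n l)%N.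
Proof.
rewrite /mibin (bigD1 i) //= [X in _ = (X + _)%N](bigD1 i) //=.
rewrite [X in _ = (_ + X)%N](bigD1 i) //= !add_mie_diag binS.
have e : (\prod_(j | j != i) 'C((n + mie i)%R j, (l + mie i)%R j) =
          \prod_(j | j != i) 'C(n j, l j))%N.
  by apply: eq_bigr => j ji; rewrite !add_mie_off.
have e' : (\prod_(j | j != i) 'C(n j, (l + mie i)%R j) =
           \prod_(j | j != i) 'C(n j, l j))%N.
  by apply: eq_bigr => j ji; rewrite !add_mie_off.
by rewrite e e' mulnDl.
Qed.

(** Pascal's rule. *)
Lemma binomial_sum_mie n i :
  binomial_sum (n + mie i) =
  binomial_sum n + extend (fun l => << l + mie i >>) (binomial_sum n).
Proof.
have inj : injective (fun l : mi d => l + mie i).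
  by move=> l l'; rewrite ![_ + mie i]addrC => /mi_addrI.
apply/malgP => l; rewrite mcoeffD !mcoeff_binomial_sum.
have [li|li] := posnP (l i).
  rewrite mibin_mie_off // mcoeff_extend big1 ?addr0 // => l' _.
  rewrite mcoeffU; case: eqP => [e|_]; last by rewrite mulr0.
  by move: li; rewrite -e add_mie_diag.
have -> : l = misub l (mie i) + mie i.
  apply/ffunP => j; have [->|ji] := eqVneq j i.
    by rewrite add_mie_diag !ffunE eqxx subn1 prednK.
  by rewrite add_mie_off // !ffunE (negbTE ji) subn0.
by rewrite (mcoeff_extend_inj _ _ inj) mcoeff_binomial_sum mibin_mie natrD.
Qed.

Lemma graft_ruleE (M : Type) a (s : dtree d M) n :
  graft_rule R a s n =
  extend (fun l => if mile l a then << (misub n l, [:: (misub a l, s)]) >> else 0)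
    (binomial_sum n).
Proof.
rewrite /graft_rule /binomial_sum extend_sum big_mkcond; apply: eq_bigr => l _.
by rewrite extendZ extendU; case: ifP => // _; rewrite scaler0.
Qed.

End BinomialSum.

Lemma prod_expr_mie (A : pzRingType) (d : nat) (x : 'I_d.+1 -> A) (k : mi d) i :
  (forall j, GRing.comm (x i) (x j)) ->
  \prod_(j < d.+1) x j ^+ (k + mie i)%R j = x i * \prod_(j < d.+1) x j ^+ k j.
Proof.
move=> xC; suff main (r : seq 'I_d.+1) : uniq r ->
  \prod_(j <- r) x j ^+ (k + mie i)%R j =
  (if i \in r then x i else 1) * \prod_(j <- r) x j ^+ k j.
  by rewrite main ?index_enum_uniq // mem_index_enum.
elim: r => [|j r IH]; first by rewrite !big_nil mul1r.
rewrite /= !big_cons inE => /andP[jr ur]; rewrite IH // mulrA.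
case: eqVneq jr => [<-|ij] jr /=.
  by rewrite (negbTE jr) mulr1 add_mie_diag exprS -mulrA.
rewrite add_mie_off 1?eq_sym // mulrA; congr (_ * _).
case: ifP => _; last by rewrite mulr1 mul1r.
by apply/esym/commrX/xC.
Qed.

Lemma mulr_swap (A : pzRingType) (p x y z : A) :
  y * x = x * y + z -> p * y * x = p * x * y + p * z.
Proof. by rewrite -!mulrA -mulrDr => ->. Qed.

Section OrderedMonomials.
Variables (R : realType) (d : nat).
Local Notation U := (U0 R d).
Implicit Types (n k : mi d) (i : 'I_d.+1) (w : planted d unit).

Definition X_pow k : U := \prod_(i < d.+1) toU (vX R i) ^+ k i.
Definition I_prod (cs : seq (planted d unit)) : U := \prod_(c <- cs) toU (vI R c).

Lemma toU_linear : linear (@toU R d).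
Proof. exact: (uinj_lie_map _).1. Qed.

Lemma toU_bracket (x y : V R d) :
  toU x * toU y = toU y * toU x + toU (bracket0 x y).
Proof.
by rewrite /toU (uinj_lie_map (@bracket0 R d)).2 addrC subrK.
Qed.

Lemma X_comm i j : GRing.comm (toU (vX R i)) (toU (vX R j)).
Proof.
have e : bracket0 (vX R i) (vX R j) = 0 by rewrite /bracket0 /bilext !lextU.
have := toU_bracket (vX R i) (vX R j).
by rewrite e (linear_raw0 toU_linear) addr0.
Qed.

Lemma I_X_comm w i :
  toU (vI R w) * toU (vX R i) =
  toU (vX R i) * toU (vI R w) + toU (IX_bracket R w i).
Proof.
have <- : bracket0 (vI R w) (vX R i) = IX_bracket R w i.
  by rewrite /bracket0 /bilext !lextU.
exact: toU_bracket.
Qed.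

Lemma X_pow_comm i k : GRing.comm (toU (vX R i)) (X_pow k).
Proof. by apply: commr_prod => j _; apply: commrX; apply: X_comm. Qed.

Lemma X_pow0 : X_pow 0 = 1.
Proof. by apply: big1 => i _; rewrite ffunE. Qed.

Lemma X_pow_mie k i : X_pow (k + mie i) = toU (vX R i) * X_pow k.
Proof.
exact: (prod_expr_mie (x := fun j => toU (vX R j)) k (X_comm i)).
Qed.

Lemma X_pow_mie_r k i : X_pow (k + mie i) = X_pow k * toU (vX R i).
Proof. by rewrite X_pow_mie; apply: X_pow_comm. Qed.

Lemma I_prod_cons c cs : I_prod (c :: cs) = toU (vI R c) * I_prod cs.
Proof. exact: big_cons. Qed.

Lemma I_prod_nil : I_prod [::] = 1.
Proof. exact: big_nil. Qed.

Lemma I_prod_cat cs ds : I_prod (cs ++ ds) = I_prod cs * I_prod ds.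
Proof. exact: big_cat. Qed.

Lemma tree_monomial_tnode n x m L :
  tree_monomial R (tnode n x m L) = X_pow n * I_prod L.
Proof.
case: x; transitivity (tree_monomial R (XI n L)); last exact: tree_monomial_XI.
rewrite /tree_monomial !root_dec_tnode.
set b := branches _; set b' := branches _.
rewrite -!tree_monomial_XI; congr (tree_monomial R _); apply: perm_tnode.
rewrite /b /b'; apply: (perm_trans (branches_tnode _ _ _ _)).
by rewrite perm_sym; apply: branches_tnode.
Qed.

(** Moving the powers of the X_i to the left of a planted tree: each
    commutation with X_i lowers the decoration of the edge by e_i, which
    produces the terms of the deformed grafting at the root. *)
Lemma I_X_pow (a : mi d) (s : tree d) n :
  toU (vI R (a, s)) * X_pow n =
  extend (fun p => X_pow p.1 * I_prod p.2) (graft_rule R a s n).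
Proof.
pose F n l := if mile l a then X_pow (misub n l) * toU (vI R (misub a l, s)) else 0.
rewrite graft_ruleE extend_comp.
transitivity (extend (F n) (binomial_sum R n)); last first.
  apply: eq_extend => l; rewrite /F; case: ifP => _; last by rewrite extend0.
  by rewrite extendU I_prod_cons I_prod_nil mulr1.
elim/mi_ind: n => [|n i IH].
  rewrite X_pow0 mulr1 binomial_sum0 extendU /F.
  have -> : mile 0 a by apply/forallP => i; rewrite ffunE.
  have -> : misub 0 0 = 0 :> mi d by apply/ffunP => i; rewrite !ffunE.
  have -> : misub a 0 = a by apply/ffunP => i; rewrite !ffunE subn0.
  by rewrite X_pow0 mul1r.
rewrite X_pow_mie_r mulrA IH binomial_sum_mie extendD extend_comp.
rewrite -extend_funD.
transitivity (extend (fun l => F n l * toU (vX R i)) (binomial_sum R n)).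
  apply: (linear_extend (h := fun A : U => A * toU (vX R i))) => c x y.
  by rewrite mulrDl scalerAl.
apply: eq_in_extend => l; rewrite mcoeff_binomial_sum extendU => nl0.
have ln : mile l n.
  by apply: contraNT nl0 => /mibin_small ->.
have leE : mile (l + mie i) a = mile l a && (0 < misub a l i)%N.
  apply/forallP/andP => [la|[/forallP la ai] j].
    split; last by have := la i; rewrite add_mie_diag ffunE subn_gt0.
    apply/forallP => j; have := la j; have [->|ji] := eqVneq j i.
      by rewrite add_mie_diag => /ltnW.
    by rewrite add_mie_off.
  have [->|ji] := eqVneq j i; last by rewrite add_mie_off.
  by rewrite add_mie_diag -subn_gt0; move: ai; rewrite ffunE.
rewrite /F leE; case: (mile l a) => /=; last by rewrite mul0r addr0.
have -> : misub (n + mie i) l = misub n l + mie i.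
  apply/ffunP => j; have [->|ji] := eqVneq j i.
    rewrite add_mie_diag ffunE add_mie_diag ffunE subSn //.
    exact: (forallP ln).
  by rewrite add_mie_off // !(ffunE, add_mie_off).
have -> : misub (n + mie i) (l + mie i) = misub n l.
  by apply/ffunP => j; rewrite !ffunE; apply: subnDr.
have -> : misub a (l + mie i) = misub (misub a l) (mie i).
  by apply/ffunP => j; rewrite !ffunE; apply: subnDA.
rewrite X_pow_mie_r.
apply: etrans (mulr_swap (X_pow (misub n l)) (I_X_comm (misub a l, s) i)) _.
apply: add_congr; first exact: erefl.
rewrite /IX_bracket; case: ifP => _; first exact: erefl.
by rewrite (linear_raw0 toU_linear) mulr0.
Qed.

End OrderedMonomials.

(** * Comparison of the two products *)

Section Transfer.
Variables (R : realType) (d : nat).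
Local Notation U := (U0 R d).
Local Notation planted := (planted d unit).
Local Notation btree := (dtree d bool).
Local Notation letter := (planted + 'I_d.+1)%type.
Implicit Types (b : letter) (cs L : seq planted).

Definition gen b : V R d := << b >>.

(** The operator on trees by which a basis element of the post-Lie algebra acts. *)
Definition rule_of b : rule R d unit :=
  match b with inl w => graft_rule R w.1 w.2 | inr i => @raise_rule R d unit i end.

Lemma tri_gen b z : tri (gen b) (vI R z) =
  extend (fun w => vI R w) (local_op_planted predT (rule_of b) z).
Proof.
rewrite /tri /bilext !lextU; case: b => [w|i]; rewrite lextE.
  by rewrite pgraftE.
rewrite plantE; congr (extend _ (planting _ _)); exact: upE.
Qed.

Lemma tri_X (x : V R d) i : tri x (vX R i) = 0.
Proof.
rewrite /tri /bilext -[RHS](extend_fun0 _ x) lextE; apply: eq_extend => b.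
by rewrite lextU; case: b.
Qed.

(** Raising creates no branch, so an operator on the false nodes finds nothing
    new to act on. *)
Lemma raise_true_commute (phi : rule R d bool) k (t : btree) :
  (forall n p, (phi n)@_p != 0 -> {in p.2, forall w, forall i,
     local_op id (@raise_rule R d bool i) w.2 = 0}) ->
  extend (local_op negb phi) (raise_true R k t) =
  extend (raise_true R k) (local_op negb phi t).
Proof.
move=> phi0; elim/mi_ind: k => [|k i IH].
  rewrite raise_true0 extendU -[LHS]extend_id; apply: eq_extend => u.
  by rewrite raise_true0.
have act0 n : act_on_rule negb phi (@raise_rule R d bool i) n = 0.
  exact: act_on_raise_rule.
transitivity (extend (local_op id (@raise_rule R d bool i))
    (extend (local_op negb phi) (raise_true R k t))).
  rewrite raise_true_mie !extend_comp; apply: eq_extend => u.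
  rewrite local_op_commutator; first last.
  - by move=> n p np w wp; apply: phi0 np w wp i.
  - by case.
  rewrite (_ : local_op id _ u = 0) ?addr0 //.
  rewrite local_op.unlock /planar_local; apply: big1 => v _.
  by rewrite act0 extend0.
rewrite IH extend_comp; apply: eq_extend => u.
by rewrite raise_true_mie.
Qed.

Lemma mark_rule_unit (phi : rule R d unit) :
  mark_rule tt (mark_rule false phi) =1 phi.
Proof.
move=> n; rewrite /mark_rule extend_comp -[RHS]extend_id.
apply: eq_extend => -[n' L]; rewrite extendU /= -map_comp; congr << (_, _) >>.
rewrite -[RHS]map_id; apply: eq_map => -[a t] /=.
by rewrite /mark_planted /= mark_mark mark_tt.
Qed.

Variable T : U -> U -> U.
Hypothesis extT : extends_product (@tri R d) T.

Lemma ext_toU (x y : V R d) : T (toU x) (toU y) = toU (tri x y).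
Proof. exact: (ext_V extT). Qed.

Lemma ext_V_X_pow (x : V R d) k : T (toU x) (X_pow R k) = 0.
Proof.
have T1 : T (toU x) 1 = 0 by exact: (ext_V1 extT).
have TX j : T (toU x) (toU (vX R j)) = 0.
  by rewrite ext_toU tri_X (linear_raw0 (@toU_linear R d)).
have TM A B : T (toU x) A = 0 -> T (toU x) B = 0 ->
    T (toU x) (A * B) = 0.
  by move=> A0 B0; rewrite (post_lie_derivation extT) A0 B0 mul0r mulr0 addr0.
apply: (big_ind (fun A => T (toU x) A = 0)) => // j _.
by elim: (k j) => [|m IH]; rewrite ?expr0 // exprS; apply: TM.
Qed.

Lemma ext_gen_I_prod b cs :
  T (toU (gen b)) (I_prod R cs) =
  extend (@I_prod R d) (leibniz id (local_op_planted predT (rule_of b)) cs).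
Proof.
elim: cs => [|c cs IH].
  by rewrite I_prod_nil extend0; apply: (ext_V1 extT).
rewrite I_prod_cons (post_lie_derivation extT) extend_leibniz_cons map_id IH.
rewrite ext_toU tri_gen; apply: add_congr.
  rewrite (linear_extend (h := @toU R d)); last exact: toU_linear.
  rewrite (linear_extend (h := fun A : U => A * I_prod R cs)); last first.
    by move=> e x y; rewrite mulrDl scalerAl.
  by apply: eq_extend => w; rewrite I_prod_cons.
rewrite (linear_extend (h := fun A : U => toU (vI R c) * A)); last first.
  by move=> e x y; rewrite mulrDr scalerAr.
by apply: eq_extend => L; rewrite I_prod_cons.
Qed.

Lemma gen_X_pow b n :
  toU (gen b) * X_pow R n =
  extend (fun p => X_pow R p.1 * I_prod R p.2) (rule_of b n).
Proof.
case: b => [[a s]|i]; first exact: I_X_pow.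
by rewrite extendU /= I_prod_nil mulr1 X_pow_mie.
Qed.

(** The operator L_x on ordered monomials: x multiplies the powers of the X_i,
    which accounts for the root, and acts on the branches by the post-Lie
    product. *)
Lemma gen_tree_monomial b t :
  toU (gen b) * tree_monomial R t + T (toU (gen b)) (tree_monomial R t) =
  extend (@tree_monomial R d) (local_op predT (rule_of b) t).
Proof.
elim/dtree_ind: t => n x m L _.
rewrite local_op_tnode extendD extend_comp tree_monomial_tnode.
rewrite (post_lie_derivation extT) ext_V_X_pow mul0r add0r ext_gen_I_prod.
rewrite mulrA gen_X_pow; apply: add_congr.
  rewrite (linear_extend (h := fun A : U => A * I_prod R L)); last first.
    by move=> e y z; rewrite mulrDl scalerAl.
  rewrite /root_op /= extend_comp; apply: eq_extend => p.
  by rewrite extendU tree_monomial_tnode I_prod_cat mulrA.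
rewrite (linear_extend (h := fun A : U => X_pow R n * A)); last first.
  by move=> e y z; rewrite mulrDr scalerAr.
by apply: eq_extend => L'; rewrite extendU tree_monomial_tnode.
Qed.

(** Both halves of the theorem: a linear map [S] on the envelope which obeys
    the Guin-Oudom recursion with respect to operators [L b] is computed by the
    product of trees, as soon as the embedding [Phi] of trees turns the
    grafting and raising operators into the [L b]. *)
Lemma transfer (S : U -> U) (Lop : letter -> U -> U) (Phi : tree d -> U)
    (sigma tau : tree d) :
  linear S -> (forall b, linear (Lop b)) ->
  (forall b A, S (toU (gen b) * A) = Lop b (S A) - S (T (toU (gen b)) A)) ->
  S 1 = Phi tau ->
  (forall b t, Lop b (Phi t) = extend Phi (local_op predT (rule_of b) t)) ->
  S (tree_monomial R sigma) = extend Phi (star2 R sigma tau).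
Proof.
move=> linS linL SM S1 LPhi.
pose Psi (t : btree) := Phi (mark tt t).
have LPsi b t : Lop b (Psi t) =
    extend Psi (local_op predT (mark_rule false (rule_of b)) t).
  rewrite /Psi LPhi -(eq_local_op _ _ (mark_rule_unit _)) local_op_mark extend_comp.
  by apply: eq_extend => u; rewrite extendU.
(* Without its part on the false nodes, an operator acts on the true ones. *)
have step b (Z : {malg R[btree]}) :
    Lop b (extend Psi Z)
    - extend Psi (extend (local_op negb (mark_rule false (rule_of b))) Z) =
    extend Psi (extend (local_op id (mark_rule false (rule_of b))) Z).
  rewrite (linear_extend _ _ (linL b)) (eq_extend _ (LPsi b)) -extend_comp -extendB.
  by rewrite (eq_extend _ (local_op_split id _)) extend_funD addrK.
(* x |> A has one factor less than x A, whence the induction on the length. *)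
have claimA cs : S (I_prod R cs) = extend Psi (multi_graft R tau cs).
  have [n ns] := ubnP (size cs); elim: n cs ns => // n IH [|c cs] ns.
    by rewrite I_prod_nil S1 extendU /Psi mark_mark mark_tt.
  rewrite I_prod_cons (SM (inl c)) IH //.
  rewrite (ext_gen_I_prod (inl c)) (linear_extend _ _ linS).
  rewrite (eq_size_leibniz (G := fun L => extend Psi (multi_graft R tau L)));
    last by move=> L szL; rewrite IH // szL.
  rewrite -(extend_comp Psi) -multi_graft_leibniz step.
  congr (extend _ _); apply: eq_extend => t.
  by apply: eq_local_op; apply: mark_graft_rule.
(* X_i |> _ kills the powers of the X_j: it only acts on the planted trees. *)
have claimB k cs : S (X_pow R k * I_prod R cs) =
    extend Psi (extend (raise_true R k) (multi_graft R tau cs)).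
  elim/mi_ind: k cs => [|k i IH] cs.
    rewrite X_pow0 mul1r claimA (eq_extend _ (@raise_true0 R d)) extend_id.
    exact: erefl.
  rewrite X_pow_mie -mulrA (SM (inr i)) IH.
  have -> : T (toU (gen (inr i))) (X_pow R k * I_prod R cs) =
    extend (fun L => X_pow R k * I_prod R L)
      (leibniz id (local_op_planted predT (rule_of (inr i))) cs).
    rewrite (post_lie_derivation extT) ext_V_X_pow mul0r add0r ext_gen_I_prod.
    apply: (linear_extend (h := fun A : U => X_pow R k * A)) => e x y.
    by rewrite mulrDr scalerAr.
  rewrite (linear_extend _ _ linS) (eq_extend _ IH).
  rewrite -(extend_comp Psi) -(extend_comp (raise_true R k)) -multi_graft_leibniz.
  have -> : extend (raise_true R k)
      (extend (local_op negb (mark_rule false (rule_of (inr i))))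
        (multi_graft R tau cs)) =
    extend (local_op negb (mark_rule false (rule_of (inr i))))
      (extend (raise_true R k) (multi_graft R tau cs)).
    rewrite !extend_comp; apply: eq_extend => t.
    apply/esym/raise_true_commute => n p; rewrite mark_raise_rule mcoeffU => np w.
    have <- : (n + mie i, [::]) = p.
      by apply/eqP; apply: contraNT np => /negbTE ->; apply/eqP.
    by [].
  rewrite step; apply: (congr1 (extend Psi)); rewrite extend_comp.
  apply: eq_extend => t.
  rewrite raise_true_mie; apply: eq_extend => u.
  by apply: eq_local_op; apply: mark_raise_rule.
rewrite [tree_monomial R sigma]/(X_pow R _ * I_prod R _) claimB.
rewrite /star2 lextE /guin_oudom size_map guin_oudom_multi_graft //.
rewrite /planting !extend_comp; apply: eq_extend => t.
rewrite extendU raise_markedE extend_comp; apply: eq_extend => u.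
by rewrite extendU.
Qed.

End Transfer.

Theorem theorem4p10 (R : realType) (d : nat) (T : U0 R d -> U0 R d -> U0 R d)
    (extT : extends_product (@tri R d) T) :
  (forall (k m : mi d) (cs ds : seq (planted d unit)),
     tree_to_U (star2 R (XI k cs) (XI m ds)) =
     star T (tree_monomial R (XI k cs)) (tree_monomial R (XI m ds)))
  /\
  (forall (k : mi d) (cs : seq (planted d unit)) (tau : tree d) (b : mi d),
     toU (lext (@vI R d) (plant b (star2 R (XI k cs) tau))) =
     T (tree_monomial R (XI k cs)) (toU (vI R (b, tau)))).
Proof.
have [Tl Tr] := ext_bilinear extT.
split=> [k m cs ds|k cs tau b].
  rewrite /tree_to_U lextE; apply/esym.
  apply: (transfer extT (S := fun A => star T A (tree_monomial R (XI m ds)))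
    (Lop := fun b C => toU (gen R b) * C + T (toU (gen R b)) C)).
  - exact: (star_linear extT).
  - move=> b c x y; rewrite mulrDr -scalerAr (linear_rawD (Tr _)).
    by rewrite (linear_rawZ (Tr _)) scalerDr addrACA.
  - move=> b A; exact: (star_mulV extT).
  - exact: (star1 extT).
  exact: (gen_tree_monomial extT).
rewrite lextE plantE.
apply/esym.
transitivity (extend (fun t => toU (vI R (b, t))) (star2 R (XI k cs) tau)).
  apply: (transfer extT (S := fun A => T A (toU (vI R (b, tau))))
    (Lop := fun b C => T (toU (gen R b)) C)).
  - exact: Tl.
  - move=> c; exact: Tr.
  - move=> c A; exact: (ext_mulV_all extT).
  - exact: (ext_1 extT).
  move=> c t; rewrite (ext_toU extT) tri_gen.
  rewrite (linear_extend (h := @toU R d)); last exact: toU_linear.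
  rewrite /local_op_planted /planting extend_comp; apply: eq_extend => u.
  by rewrite extendU.
rewrite -(linear_extend (h := @toU R d)); last exact: toU_linear.
congr (toU _); rewrite /planting extend_comp; apply: eq_extend => t.
by rewrite extendU.
Qed.
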